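(* Let $R$ be a regular ring (in the sense of Vogel) and $S$ an $R$-bimodule, flat on the left. Let $n\ge 0$ and let $C_*$ be a reduced $\mathcal{D}_0$-complex in $\tilde{\mathcal{A}}$. Then $C_*$ is $\mathcal{A}_n$-local if and only if the map $\lambda$ induces a homology equivalence between $\mathrm{Ker}(\alpha_m)$ and $\mathrm{Ker}(\alpha_{m+1})$ for every index $1\le m<n$.
   Context: A ring $R$ is regular in the sense of Vogel if the smallest class of right $R$-modules containing the finitely generated projective modules, closed under filtered colimits and satisfying the 2/3 property for short exact sequences, is the class of all right $R$-modules. Complexes are $\mathbb{Z}$-graded with differential of degree $-1$, and are complexes of projective right $R$-modules. A complex is finite if the direct sum of its terms is finitely generated; it is h-finite if it is chain homotopy equivalent to a finite complex. A $\mathcal{D}_0$-complex $C_*$ consists of complexes $C_i$ of projective right $R$-modules ($i\in\mathbb{N}$) with chain maps $\lambda_i:C_i\to C_{i+1}$ and $\alpha_{i+1}:C_{i+1}\to C_i\otimes_R S$ satisfying $\alpha\circ\lambda=\lambda\circ\alpha$, i.e. $\alpha_{i+1}\lambda_i=(\lambda_{i-1}\otimes S)\alpha_i:C_i\to C_i\otimes_R S$ (so $\lambda_i$ maps $\mathrm{Ker}(\alpha_i)$ into $\mathrm{Ker}(\alpha_{i+1})$). Acyclicity, exactness and homology equivalences are understood for each index $i$. For $n\ge0$, $\mathcal{B}_n$ is the class of $\mathcal{D}_0$-complexes $B_*$ with $B_0=0$, each $B_i$ h-finite, each $\lambda_i$ a cofibration, and $\lambda_i$ a weak (homology) equivalence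 for all $i\ge n$. $\mathcal{A}_n$ is the class of $B_*\in\mathcal{B}_n$ such that $B_n$ is contractible, and $\mathcal{A}=\varinjlim\mathcal{A}_n$ is the union along the inclusions $\mathcal{A}_n\subset\mathcal{A}_{n+1}$. A $\mathcal{D}_0$-complex is reduced if all maps $\alpha_i$ are surjective. A class of $\mathcal{D}_0$-complexes is exact if it contains all finite acyclic $\mathcal{D}_0$-complexes and satisfies the 2/3 axiom for short exact sequences. $\tilde{\mathcal{A}}$ is the completion of $\mathcal{A}$: the smallest exact class containing $\mathcal{A}$ and stable under arbitrary direct sums. A $\mathcal{D}_0$-complex $X$ is $\mathcal{A}_n$-local if every morphism $Y\to X$ with $Y\in\mathcal{A}_n$ factorizes through an acyclic $\mathcal{D}_0$-complex. *)

(* Defs.v *)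
From HB Require Import structures.
From mathcomp Require Import all_boot all_order all_algebra.
From mathcomp Require Import boolp.

Set Implicit Arguments.
Unset Strict Implicit.
Unset Printing Implicit Defensive.

Import GRing.Theory.
Local Open Scope ring_scope.
Local Open Scope quotient_scope.

(* Right R-modules are left modules over the converse ring R^c:
   the right action x . r is (r : R^c) *: x. *)
Notation rmodType R := (lmodType R^c).

(* The right R-module structure is the canonical one of the carrier. *)
Record bimodule (R : pzRingType) := Bimodule {
  bimod_sort :> rmodType R;
  lact : R -> bimod_sort -> bimod_sort;
  lact1 : forall y, lact 1 y = y;
  lactA : forall a b y, lact a (lact b y) = lact (a * b) y;
  lactDl : forall a b y, lact (a + b) y = lact a y + lact b y;
  lactDr : forall a y z, lact a (y + z) = lact a y + lact a z;
  lact_ract : forall a (b : R^c) y, lact a (b *: y) = b *: lact a y }.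

Section Modules.
Variable R : pzRingType.

Section ShortExact.
Variables (A B C : rmodType R) (f : {linear A -> B}) (g : {linear B -> C}).

Definition short_exact :=
  [/\ injective f, forall y, g y = 0 <-> (exists x, f x = y)
    & forall z, exists y, g y = z].

End ShortExact.

Definition projective (P : rmodType R) :=
  forall (A B : rmodType R) (p : {linear A -> B}) (f : {linear P -> B}),
    (forall b, exists a, p a = b) ->
  exists g : {linear P -> A}, forall x, p (g x) = f x.

Definition finitely_generated (M : rmodType R) :=
  exists (n : nat) (e : 'I_n -> M),
    forall x, exists c : 'I_n -> R^c, x = \sum_(i < n) c i *: e i.

Definition is_direct_sum (J : Type) (F : J -> rmodType R) (M : rmodType R)
    (iota : forall j, {linear F j -> M}) :=
  forall (N : rmodType R) (g : forall j, {linear F j -> N}),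
  exists h : {linear M -> N},
    (forall j x, h (iota j x) = g j x) /\
    (forall h' : {linear M -> N},
       (forall j x, h' (iota j x) = g j x) -> forall x, h' x = h x).

End Modules.

Record filtered_category := FilteredCategory {
  fc_obj :> Type;
  fc_hom : fc_obj -> fc_obj -> Type;
  fc_id : forall i, fc_hom i i;
  fc_comp : forall i j k, fc_hom j k -> fc_hom i j -> fc_hom i k;
  fc_idl : forall i j (u : fc_hom i j), fc_comp (fc_id j) u = u;
  fc_idr : forall i j (u : fc_hom i j), fc_comp u (fc_id i) = u;
  fc_compA : forall i j k l (w : fc_hom k l) (v : fc_hom j k) (u : fc_hom i j),
    fc_comp w (fc_comp v u) = fc_comp (fc_comp w v) u;
  fc_inhabited : inhabited fc_obj;
  fc_join : forall i j, exists k, inhabited (fc_hom i k) /\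
                                  inhabited (fc_hom j k);
  fc_coeq : forall i j (u v : fc_hom i j),
    exists k (w : fc_hom j k), fc_comp w u = fc_comp w v }.

Section Regular.
Variable R : pzRingType.

Record diagram (I : filtered_category) := Diagram {
  dg_obj :> I -> rmodType R;
  dg_map : forall i j : I, fc_hom i j -> {linear dg_obj i -> dg_obj j};
  dg_id : forall i x, dg_map (fc_id i) x = x;
  dg_comp : forall (i j k : I) (v : fc_hom j k) (u : fc_hom i j) x,
    dg_map (fc_comp v u) x = dg_map v (dg_map u x) }.

Definition is_cocone (I : filtered_category) (D : diagram I) (M : rmodType R)
    (c : forall i, {linear D i -> M}) :=
  forall (i j : I) (u : fc_hom i j) x, c j (dg_map D u x) = c i x.

Definition is_colimit (I : filtered_category) (D : diagram I) (M : rmodType R)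
    (c : forall i, {linear D i -> M}) :=
  is_cocone c /\
  forall (N : rmodType R) (g : forall i, {linear D i -> N}), is_cocone g ->
  exists h : {linear M -> N},
    (forall i x, h (c i x) = g i x) /\
    (forall h' : {linear M -> N},
       (forall i x, h' (c i x) = g i x) -> forall x, h' x = h x).

Definition closed_filtered_colimits (P : rmodType R -> Prop) :=
  forall (I : filtered_category) (D : diagram I) (M : rmodType R)
    (c : forall i, {linear D i -> M}),
  is_colimit c -> (forall i, P (D i)) -> P M.

Definition modules_two_of_three (P : rmodType R -> Prop) :=
  forall (A B C : rmodType R) (f : {linear A -> B}) (g : {linear B -> C}),
  short_exact f g ->
  [/\ P A -> P B -> P C, P A -> P C -> P B & P B -> P C -> P A].

Definition vogel_regular :=
  forall P : rmodType R -> Prop,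
    (forall M, finitely_generated M -> projective M -> P M) ->
    closed_filtered_colimits P ->
    modules_two_of_three P ->
  forall M, P M.

End Regular.

Section Kernel.
Variables (R : pzRingType) (U V : lmodType R) (f : {linear U -> V}).

Definition ker_pred : {pred U} := fun x => f x == 0.

Lemma ker_pred_closed : submod_closed ker_pred.
Proof.
split=> [|a x y]; first by rewrite unfold_in linear0.
by rewrite !unfold_in linearP => /eqP-> /eqP->; rewrite scaler0 addr0.
Qed.

HB.instance Definition _ := GRing.isSubmodClosed.Build R U ker_pred
  ker_pred_closed.

Record kernel := Kernel { ker_val : U; ker_valP : ker_val \in ker_pred }.

HB.instance Definition _ := [isSub for ker_val].
HB.instance Definition _ := [Choice of kernel by <:].
HB.instance Definition _ := [SubChoice_isSubLmodule of kernel by <:].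

End Kernel.

Section KernelMap.
Variables (R : pzRingType) (U V U' V' : lmodType R).
Variables (f : {linear U -> V}) (f' : {linear U' -> V'}).
Variables (u : {linear U -> U'}).
Hypothesis Hu : forall x, f x = 0 -> f' (u x) = 0.

Lemma ker_map_subproof (x : kernel f) : u (val x) \in ker_pred f'.
Proof. by apply/eqP/Hu/eqP; exact: (ker_valP x). Qed.

Definition ker_map (x : kernel f) : kernel f' := Kernel (ker_map_subproof x).

Lemma ker_map_is_linear : linear ker_map.
Proof. by move=> a x y; apply: val_inj; rewrite /= linearP. Qed.

HB.instance Definition _ := GRing.isLinear.Build R (kernel f) (kernel f') _
  ker_map ker_map_is_linear.

End KernelMap.

(* M (x)_R S is presented as the commutative monoid of finite formal sums of
   pairs (x, y) modulo the tensor relations; inverses come from (- x, y). *)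
Section Tensor.
Variables (R : pzRingType) (S : bimodule R).

Section Construction.
Variable M : rmodType R.

Inductive tens_rel : seq (M * S) -> seq (M * S) -> Prop :=
| tens_refl s : tens_rel s s
| tens_sym s t : tens_rel s t -> tens_rel t s
| tens_trans s t u : tens_rel s t -> tens_rel t u -> tens_rel s u
| tens_cat s s' t t' :
    tens_rel s s' -> tens_rel t t' -> tens_rel (s ++ t) (s' ++ t')
| tens_catC s t : tens_rel (s ++ t) (t ++ s)
| tens_zero y : tens_rel [:: (0, y)] [::]
| tens_addl x x' y : tens_rel [:: (x + x', y)] [:: (x, y); (x', y)]
| tens_addr x y y' : tens_rel [:: (x, y + y')] [:: (x, y); (x, y')]
| tens_balanced (x : M) (r : R) y :
    tens_rel [:: ((r : R^c) *: x, y)] [:: (x, lact r y)].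

Definition tens_eqv (s t : seq (M * S)) : bool := `[< tens_rel s t >].

Lemma tens_eqv_refl : reflexive tens_eqv.
Proof. by move=> s; apply/asboolP; constructor. Qed.

Lemma tens_eqv_sym : symmetric tens_eqv.
Proof. by move=> s t; apply/asboolP/asboolP => /tens_sym. Qed.

Lemma tens_eqv_trans : transitive tens_eqv.
Proof.
by move=> t s u /asboolP st /asboolP tu; apply/asboolP/(tens_trans st tu).
Qed.

Canonical tens_equiv :=
  EquivRel tens_eqv tens_eqv_refl tens_eqv_sym tens_eqv_trans.

Definition tensor := {eq_quot tens_equiv}.
HB.instance Definition _ := Choice.on tensor.
HB.instance Definition _ := EqQuotient.on tensor.

Definition tens_class (s : seq (M * S)) : tensor := \pi_tensor s.

Definition tens (x : M) (y : S) : tensor := tens_class [:: (x, y)].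

Lemma tens_classP s t : tens_class s = tens_class t <-> tens_rel s t.
Proof.
by split=> [/eqmodP/asboolP//|st]; apply/eqmodP/asboolP.
Qed.

Lemma tens_class_repr (u : tensor) : tens_class (repr u) = u.
Proof. exact: reprK. Qed.

Lemma tens_repr s : tens_rel (repr (tens_class s)) s.
Proof. by apply/tens_classP; rewrite tens_class_repr. Qed.

Definition tens_add (u v : tensor) : tensor := tens_class (repr u ++ repr v).

Definition tens_opp (u : tensor) : tensor :=
  tens_class [seq (- p.1, p.2) | p <- repr u].

Definition tens_scale (r : R^c) (u : tensor) : tensor :=
  tens_class [seq (p.1, r *: p.2) | p <- repr u].

Lemma tens_addE s t : tens_add (tens_class s) (tens_class t) =
  tens_class (s ++ t).
Proof. by apply/tens_classP/tens_cat; exact: tens_repr. Qed.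

Lemma tens_rel_opp s t : tens_rel s t ->
  tens_rel [seq (- p.1, p.2) | p <- s] [seq (- p.1, p.2) | p <- t].
Proof.
elim=> {s t} /=.
- by move=> s; exact: tens_refl.
- by move=> s t _; exact: tens_sym.
- by move=> s t u _ H _; exact: tens_trans.
- by move=> s s' t t' _ H _ H'; rewrite !map_cat; exact: tens_cat.
- by move=> s t; rewrite !map_cat; exact: tens_catC.
- by move=> y; rewrite oppr0; exact: tens_zero.
- by move=> x x' y; rewrite opprD; exact: tens_addl.
- by move=> x y y'; exact: tens_addr.
- by move=> x r y; rewrite -scalerN; exact: tens_balanced.
Qed.

Lemma tens_oppE s :
  tens_opp (tens_class s) = tens_class [seq (- p.1, p.2) | p <- s].
Proof. by apply/tens_classP/tens_rel_opp; exact: tens_repr. Qed.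

Lemma tens_rel_scale (r : R^c) s t : tens_rel s t ->
  tens_rel [seq (p.1, r *: p.2) | p <- s] [seq (p.1, r *: p.2) | p <- t].
Proof.
elim=> {s t} /=.
- by move=> s; exact: tens_refl.
- by move=> s t _; exact: tens_sym.
- by move=> s t u _ H _; exact: tens_trans.
- by move=> s s' t t' _ H _ H'; rewrite !map_cat; exact: tens_cat.
- by move=> s t; rewrite !map_cat; exact: tens_catC.
- by move=> y; exact: tens_zero.
- by move=> x x' y; exact: tens_addl.
- by move=> x y y'; rewrite scalerDr; exact: tens_addr.
- by move=> x a y; rewrite -lact_ract; exact: tens_balanced.
Qed.

Lemma tens_scaleE r s :
  tens_scale r (tens_class s) = tens_class [seq (p.1, r *: p.2) | p <- s].
Proof. by apply/tens_classP/tens_rel_scale; exact: tens_repr. Qed.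

Lemma tens_addA : associative tens_add.
Proof.
move=> u v w; rewrite -(tens_class_repr u) -(tens_class_repr v).
by rewrite -(tens_class_repr w) !tens_addE catA.
Qed.

Lemma tens_addC : commutative tens_add.
Proof.
move=> u v; rewrite -(tens_class_repr u) -(tens_class_repr v) !tens_addE.
exact/tens_classP/tens_catC.
Qed.

Lemma tens_add0 : left_id (tens_class [::]) tens_add.
Proof. by move=> u; rewrite -(tens_class_repr u) tens_addE. Qed.

Lemma tens_addN : left_inverse (tens_class [::]) tens_opp tens_add.
Proof.
move=> u; rewrite -(tens_class_repr u) tens_oppE.
elim: (repr u) => [|[x y] s IH] /=; first by rewrite tens_addE.
have cons_add p t : tens_class (p :: t) =
    tens_add (tens_class [:: p]) (tens_class t) by rewrite tens_addE.
rewrite [tens_class (_ :: map _ _)]cons_add [tens_class (_ :: s)]cons_add.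
rewrite (tens_addC (tens_class [:: (- x, y)])) tens_addA.
rewrite -(tens_addA _ (tens_class [:: (- x, y)])) tens_addE.
have -> : tens_class ([:: (- x, y)] ++ [:: (x, y)]) = tens_class [::].
  apply/tens_classP; apply: tens_trans (tens_zero y).
  by rewrite -(addNr x); apply/tens_sym/tens_addl.
by rewrite (tens_addC _ (tens_class [::])) tens_add0.
Qed.

HB.instance Definition _ := GRing.isZmodule.Build tensor
  tens_addA tens_addC tens_add0 tens_addN.

Lemma tens_scaleA a b v : tens_scale a (tens_scale b v) = tens_scale (a * b) v.
Proof.
rewrite -(tens_class_repr v) !tens_scaleE -map_comp.
by congr tens_class; apply: eq_map => p /=; rewrite scalerA.
Qed.

Lemma tens_scale1 : left_id 1 tens_scale.
Proof.
move=> v; rewrite -(tens_class_repr v) tens_scaleE; congr tens_class.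
by rewrite -[RHS]map_id; apply: eq_map => -[x y] /=; rewrite scale1r.
Qed.

Lemma tens_scaleDr : right_distributive tens_scale +%R.
Proof.
move=> a u v; rewrite -(tens_class_repr u) -(tens_class_repr v).
by rewrite [_ + _]tens_addE !tens_scaleE [_ + _]tens_addE map_cat.
Qed.

Lemma tens_scaleDl v : {morph tens_scale^~ v: a b / a + b}.
Proof.
move=> a b; rewrite -(tens_class_repr v) !tens_scaleE [RHS]tens_addE.
apply/tens_classP; elim: (repr v) => [|[x y] s IH] /=; first exact: tens_refl.
apply: (tens_trans (t := [:: (x, a *: y); (x, b *: y)] ++
   ([seq (p.1, a *: p.2) | p <- s] ++ [seq (p.1, b *: p.2) | p <- s]))).
  rewrite -cat1s; apply: tens_cat IH; rewrite scalerDl; exact: tens_addr.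
set A := map _ s; set B := map _ s.
have -> : (x, a *: y) :: A ++ (x, b *: y) :: B =
    [:: (x, a *: y)] ++ ((A ++ [:: (x, b *: y)]) ++ B) by rewrite -catA.
apply: (@tens_cat [:: (x, a *: y)] _ (([:: (x, b *: y)] ++ A) ++ B)).
  exact: tens_refl.
by apply: tens_cat; [exact: tens_catC | exact: tens_refl].
Qed.

HB.instance Definition _ := GRing.Zmodule_isLmodule.Build R^c tensor
  tens_scaleA tens_scale1 tens_scaleDr tens_scaleDl.

Lemma tensDl x x' y : tens (x + x') y = tens x y + tens x' y.
Proof. by rewrite [RHS]tens_addE; apply/tens_classP/tens_addl. Qed.

Lemma tensDr x y y' : tens x (y + y') = tens x y + tens x y'.
Proof. by rewrite [RHS]tens_addE; apply/tens_classP/tens_addr. Qed.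

Lemma tens_lact (x : M) (r : R) y : tens ((r : R^c) *: x) y = tens x (lact r y).
Proof. exact/tens_classP/tens_balanced. Qed.

Lemma tens_ract (r : R^c) x y : r *: tens x y = tens x (r *: y).
Proof. by rewrite [LHS]tens_scaleE. Qed.

Lemma tensE (u : tensor) : u = \sum_(p <- repr u) tens p.1 p.2.
Proof.
rewrite -[LHS]tens_class_repr; elim: (repr u) => [|[x y] s IH].
  by rewrite big_nil.
by rewrite big_cons -IH [RHS]tens_addE.
Qed.

Lemma tens_lift (N : rmodType R) (b : M -> S -> N) :
    (forall x x' y, b (x + x') y = b x y + b x' y) ->
    (forall x (r : R^c) y y', b x (r *: y + y') = r *: b x y + b x y') ->
    (forall x (r : R) y, b ((r : R^c) *: x) y = b x (lact r y)) ->
  exists h : {linear tensor -> N}, forall x y, h (tens x y) = b x y.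
Proof.
move=> bDl bP bbal.
have bDr x y y' : b x (y + y') = b x y + b x y'.
  by have := bP x 1 y y'; rewrite !scale1r.
have b0l y : b 0 y = 0.
  by apply: (addIr (b 0 y)); rewrite -bDl !add0r.
have b0r x : b x 0 = 0 by apply: (addIr (b x 0)); rewrite -bDr !add0r.
pose v s := \sum_(p <- s) b p.1 p.2.
have v_rel s t : tens_rel s t -> v s = v t.
  elim=> {s t} //.
  - by move=> s t u _ -> _ ->.
  - by move=> s s' t t' _ + _; rewrite /v !big_cat /= => -> ->.
  - by move=> s t; rewrite /v !big_cat /= addrC.
  - by move=> y; rewrite /v big_cons big_nil b0l addr0.
  - by move=> x x' y; rewrite /v !big_cons !big_nil /= bDl !addr0.
  - by move=> x y y'; rewrite /v !big_cons !big_nil /= bDr !addr0.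
  - by move=> x r y; rewrite /v !big_cons !big_nil /= bbal.
pose h (u : tensor) := v (repr u).
have hE s : h (tens_class s) = v s by apply/v_rel/tens_repr.
have h_lin : linear h.
  move=> r u w; rewrite -(tens_class_repr u) -(tens_class_repr w).
  have -> : r *: tens_class (repr u) + tens_class (repr w) =
    tens_class ([seq (p.1, r *: p.2) | p <- repr u] ++ repr w).
    by rewrite [_ *: _]tens_scaleE [LHS]tens_addE.
  rewrite !hE /v big_cat big_map /= scaler_sumr; congr (_ + _).
  by apply: eq_bigr => p _; have := bP p.1 r p.2 0; rewrite b0r !addr0.
pose hM := GRing.isLinear.Build R^c tensor N _ h h_lin.
pose hL : {linear tensor -> N} := HB.pack h hM.
by exists hL => x y; rewrite /= hE /v big_cons big_nil addr0.
Qed.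

End Construction.

Section Map.
Variables (M N : rmodType R) (f : {linear M -> N}).

Definition tens_map (u : tensor M) : tensor N :=
  tens_class [seq (f p.1, p.2) | p <- repr u].

Lemma tens_rel_map (s t : seq (M * S)) : tens_rel s t ->
  tens_rel [seq (f p.1, p.2) | p <- s] [seq (f p.1, p.2) | p <- t].
Proof.
elim=> {s t} /=.
- by move=> s; exact: tens_refl.
- by move=> s t _; exact: tens_sym.
- by move=> s t u _ H _; exact: tens_trans.
- by move=> s s' t t' _ H _ H'; rewrite !map_cat; exact: tens_cat.
- by move=> s t; rewrite !map_cat; exact: tens_catC.
- by move=> y; rewrite linear0; exact: tens_zero.
- by move=> x x' y; rewrite linearD; exact: tens_addl.
- by move=> x y y'; exact: tens_addr.
- by move=> x r y; rewrite linearZ; exact: tens_balanced.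
Qed.

Lemma tens_mapE (s : seq (M * S)) :
  tens_map (tens_class s) = tens_class [seq (f p.1, p.2) | p <- s].
Proof. by apply/tens_classP/tens_rel_map; exact: tens_repr. Qed.

Lemma tens_map_is_linear : linear tens_map.
Proof.
move=> r u v; rewrite -(tens_class_repr u) -(tens_class_repr v).
rewrite [r *: tens_class _]tens_scaleE [_ + tens_class _ in LHS]tens_addE.
rewrite !tens_mapE [r *: _]tens_scaleE [RHS]tens_addE map_cat.
by rewrite -!map_comp.
Qed.

HB.instance Definition _ := GRing.isLinear.Build R^c (tensor M) (tensor N) _
  tens_map tens_map_is_linear.

Lemma tens_map_tens x y : tens_map (tens x y) = tens (f x) y.
Proof. exact: tens_mapE. Qed.

End Map.

Lemma eq_tens_map_comp (L M M' N : rmodType R)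
    (g : {linear M -> N}) (f : {linear L -> M})
    (g' : {linear M' -> N}) (f' : {linear L -> M'}) :
  (forall x, g (f x) = g' (f' x)) ->
  forall u, tens_map g (tens_map f u) = tens_map g' (tens_map f' u).
Proof.
move=> eqgf u; rewrite -(tens_class_repr u) !tens_mapE -!map_comp.
by congr tens_class; apply: eq_map => p /=; rewrite eqgf.
Qed.

Lemma tens_map_comp0 (L M N : rmodType R)
    (g : {linear M -> N}) (f : {linear L -> M}) :
  (forall x, g (f x) = 0) -> forall u, tens_map g (tens_map f u) = 0.
Proof.
move=> gf0 u; rewrite -(tens_class_repr u) !tens_mapE -!map_comp.
apply/tens_classP; elim: (repr u) => [|[x y] s IH] /=; first exact: tens_refl.
rewrite -cat1s -[[::] in X in tens_rel _ X]cats0.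
by apply: tens_cat IH; rewrite gf0; exact: tens_zero.
Qed.

Definition flat_on_left :=
  forall (M N : rmodType R) (f : {linear M -> N}),
  injective f -> injective (tens_map f).

End Tensor.

Arguments tens_map {R} S {M N} f u.

(* The differential out of degree k + 1 is diff k : C_(k+1) -> C_k; conditions
   on the degrees k - 1, k, k + 1 are therefore stated after a shift of the
   quantified k, which loses nothing since k ranges over all of int. *)
Record complex (R : pzRingType) := Complex {
  term :> int -> rmodType R;
  diff : forall k : int, {linear term (k + 1) -> term k};
  diffK : forall (k : int) x, diff k (diff (k + 1) x) = 0 }.

Record chain_map (R : pzRingType) (C D : complex R) := ChainMap {
  chain_fun :> forall k : int, {linear C k -> D k};
  chain_comm : forall (k : int) x,
    chain_fun k (diff C k x) = diff D k (chain_fun (k + 1) x) }.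

Section Complexes.
Variable R : pzRingType.
Implicit Types C D : complex R.

Definition chain_id C : chain_map C C :=
  @ChainMap R C C (fun k => idfun) (fun k x => erefl).

Lemma chain_comp_subproof (C D E : complex R) (g : chain_map D E)
    (f : chain_map C D) k x :
  (g k \o f k) (diff C k x) = diff E k ((g (k + 1) \o f (k + 1)) x).
Proof. by rewrite /= !chain_comm. Qed.

Definition chain_comp (C D E : complex R) (g : chain_map D E)
    (f : chain_map C D) : chain_map C E :=
  @ChainMap R C E (fun k => g k \o f k) (chain_comp_subproof g f).

Lemma chain_zero_subproof C D k x :
  (\0 : C k -> D k) (diff C k x) = diff D k ((\0 : C (k + 1) -> D (k + 1)) x).
Proof. by rewrite /= linear0. Qed.

Definition chain_zero C D : chain_map C D :=
  @ChainMap R C D (fun k => \0) (@chain_zero_subproof C D).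

Definition homotopic C D (f g : chain_map C D) :=
  exists h : forall k : int, {linear C k -> D (k + 1)},
    forall (k : int) (x : C (k + 1)),
      f (k + 1) x - g (k + 1) x = diff D (k + 1) (h (k + 1) x) + h k (diff C k x).

Definition homotopy_equivalent C D :=
  exists (f : chain_map C D) (g : chain_map D C),
    homotopic (chain_comp g f) (chain_id C) /\
    homotopic (chain_comp f g) (chain_id D).

Definition contractible C := homotopic (chain_id C) (chain_zero C C).

Definition projective_complex C := forall k : int, projective (C k).

Definition finite_complex C :=
  exists (M : rmodType R) (iota : forall k : int, {linear C k -> M}),
    is_direct_sum iota /\ finitely_generated M.

Definition h_finite C :=
  exists F : complex R,
    [/\ projective_complex F, finite_complex F & homotopy_equivalent C F].

Definition zero_complex C := forall (k : int) (x : C k), x = 0.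

Definition is_cycle C (k : int) (x : C (k + 1)) := diff C k x = 0.

Definition homologous C (k : int) (x y : C (k + 1)) :=
  exists z, diff C (k + 1) z = x - y.

Definition acyclic C := forall (k : int) (x : C (k + 1)), is_cycle x -> homologous x 0.

(* Bijectivity of the map induced by f on cycles modulo boundaries, in every
   degree. *)
Definition homology_equivalence C D (f : chain_map C D) :=
  forall k : int,
    (forall x y : C (k + 1), is_cycle x -> is_cycle y ->
       homologous (f (k + 1) x) (f (k + 1) y) -> homologous x y) /\
    (forall y : D (k + 1), is_cycle y ->
       exists x : C (k + 1), is_cycle x /\ homologous (f (k + 1) x) y).

Definition short_exact_complexes (A B C : complex R) (f : chain_map A B)
    (g : chain_map B C) :=
  forall k : int, short_exact (f k) (g k).

(* Injective chain maps whose cokernel is a complex of projectives. *)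
Definition cofibration C D (f : chain_map C D) :=
  exists (Q : complex R) (p : chain_map D Q),
    projective_complex Q /\ short_exact_complexes f p.

Section KernelComplex.
Variables (C D : complex R) (f : chain_map C D).

Lemma ker_complex_comm k x : f (k + 1) x = 0 -> f k (diff C k x) = 0.
Proof. by rewrite chain_comm => ->; rewrite linear0. Qed.

Definition ker_complex_term k : rmodType R := kernel (f k).

Definition ker_complex_diff k :
    {linear ker_complex_term (k + 1) -> ker_complex_term k} :=
  ker_map (@ker_complex_comm k).

Lemma ker_complex_diffK k x :
  ker_complex_diff k (ker_complex_diff (k + 1) x) = 0.
Proof. by apply: val_inj; exact: diffK. Qed.

Definition ker_complex : complex R := Complex ker_complex_diffK.

End KernelComplex.

Section KernelComplexMap.
Variables (C D C' D' : complex R) (f : chain_map C D) (f' : chain_map C' D').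
Variable u : chain_map C C'.
Hypothesis Hu : forall k x, f k x = 0 -> f' k (u k x) = 0.

Definition ker_complex_map_fun k : {linear ker_complex f k -> ker_complex f' k} :=
  ker_map (@Hu k).

Lemma ker_complex_map_comm k x :
  ker_complex_map_fun k (diff (ker_complex f) k x) =
  diff (ker_complex f') k (ker_complex_map_fun (k + 1) x).
Proof. by apply: val_inj; exact: chain_comm. Qed.

Definition ker_complex_map : chain_map (ker_complex f) (ker_complex f') :=
  ChainMap ker_complex_map_comm.

End KernelComplexMap.

Section TensorComplex.
Variable S : bimodule R.

Definition tens_complex C : complex R :=
  @Complex R (fun k => tensor S (C k)) (fun k => tens_map S (diff C k))
    (fun k => tens_map_comp0 (@diffK R C k)).

Definition tens_chain C D (f : chain_map C D) :
    chain_map (tens_complex C) (tens_complex D) :=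
  @ChainMap R (tens_complex C) (tens_complex D) (fun k => tens_map S (f k))
    (fun k => eq_tens_map_comp (@chain_comm R C D f k)).

End TensorComplex.

End Complexes.

(* d0_alpha i is the map alpha_(i+1). The relation is imposed between C_i and
   C_i (x) S for i >= 1, where both of its sides are defined. *)
Record D0_complex (R : pzRingType) (S : bimodule R) := D0Complex {
  d0_obj :> nat -> complex R;
  d0_proj : forall i, projective_complex (d0_obj i);
  d0_lambda : forall i, chain_map (d0_obj i) (d0_obj i.+1);
  d0_alpha : forall i, chain_map (d0_obj i.+1) (tens_complex S (d0_obj i));
  d0_comm : forall i k x,
    d0_alpha i.+1 k (d0_lambda i.+1 k x) =
    tens_chain S (d0_lambda i) k (d0_alpha i k x) }.

Record D0_map (R : pzRingType) (S : bimodule R) (X Y : D0_complex S) := D0Map {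
  d0_fun :> forall i, chain_map (X i) (Y i);
  d0_fun_lambda : forall i k x,
    d0_fun i.+1 k (d0_lambda X i k x) = d0_lambda Y i k (d0_fun i k x);
  d0_fun_alpha : forall i k x,
    tens_chain S (d0_fun i) k (d0_alpha X i k x) =
    d0_alpha Y i k (d0_fun i.+1 k x) }.

Section D0.
Variables (R : pzRingType) (S : bimodule R).
Implicit Types X Y Z : D0_complex S.

(* Acyclicity, finiteness and exactness are meant for each index. *)
Definition D0_acyclic X := forall i, acyclic (X i).

Definition D0_finite X := forall i, finite_complex (X i).

Definition D0_short_exact X Y Z (f : D0_map X Y) (g : D0_map Y Z) :=
  forall i, short_exact_complexes (f i) (g i).

Definition D0_direct_sum (J : Type) (F : J -> D0_complex S) X
    (iota : forall j, D0_map (F j) X) :=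
  forall i k, is_direct_sum (fun j => iota j i k).

Definition D0_reduced X := forall i k y, exists x, d0_alpha X i k x = y.

Definition class_B (n : nat) X :=
  [/\ zero_complex (X 0%N), forall i, h_finite (X i),
      forall i, cofibration (d0_lambda X i)
    & forall i, (n <= i)%N -> homology_equivalence (d0_lambda X i)].

Definition class_An (n : nat) X := class_B n X /\ contractible (X n).

Definition class_A X := exists n, class_An n X.

Definition exact_class (P : D0_complex S -> Prop) :=
  (forall X, D0_finite X -> D0_acyclic X -> P X) /\
  (forall X Y Z (f : D0_map X Y) (g : D0_map Y Z), D0_short_exact f g ->
     [/\ P X -> P Y -> P Z, P X -> P Z -> P Y & P Y -> P Z -> P X]).

Definition stable_direct_sums (P : D0_complex S -> Prop) :=
  forall (J : Type) (F : J -> D0_complex S) X (iota : forall j, D0_map (F j) X),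
  D0_direct_sum iota -> (forall j, P (F j)) -> P X.

Definition completion (A : D0_complex S -> Prop) X :=
  forall P : D0_complex S -> Prop,
    exact_class P -> stable_direct_sums P -> (forall Y, A Y -> P Y) -> P X.

Definition local_for (A : D0_complex S -> Prop) X :=
  forall Y (f : D0_map Y X), A Y ->
  exists (Z : D0_complex S) (g : D0_map Y Z) (h : D0_map Z X),
    D0_acyclic Z /\ forall i k y, f i k y = h i k (g i k y).

(* Indexed as d0_alpha: ker_alpha X i is Ker (alpha_(i+1)), and ker_lambda X i
   is the map Ker (alpha_(i+1)) -> Ker (alpha_(i+2)) induced by lambda_(i+1). *)
Definition ker_alpha X (i : nat) : complex R := ker_complex (d0_alpha X i).

Lemma ker_lambda_subproof X i k x :
  d0_alpha X i k x = 0 -> d0_alpha X i.+1 k (d0_lambda X i.+1 k x) = 0.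
Proof. by rewrite d0_comm => ->; rewrite linear0. Qed.

Definition ker_lambda X (i : nat) :
    chain_map (ker_alpha X i) (ker_alpha X i.+1) :=
  ker_complex_map (@ker_lambda_subproof X i).

End D0.

(* Main.v *)
From HB Require Import structures.
From mathcomp Require Import all_boot all_order all_algebra.
From mathcomp Require Import boolp.
From mathcomp Require Import zify.
Require Import Defs.

(**
For [0 < m] and a complex [F] of projectives let T(F, m) be the D_0-complex
with [F] at index [m], zero below, a cone of [F] above, and alpha = 0. A map
T(F, m) -> C is a chain map F -> Ker alpha_m together with a nullhomotopy of
its image in Ker alpha_(m+1): a chain map from [F] to the homotopy fibre of
lambda : Ker alpha_m -> Ker alpha_(m+1). That this lambda is a homology
equivalence means that the fibre is acyclic, which is [fiber_exact], and both
sides of the theorem say that all maps from certain D_0-complexes to [C] are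
trivial.

Suppose that [C] is local. For [F] free of rank one, T(F, m) belongs to A_n as
soon as m < n. So each cycle of the fibre comes from a cycle in an acyclic
D_0-complex Z; there it bounds up to corrections in Z (x) S, which is acyclic
because S is flat, and surjectivity of the alpha of [C] turns the images of
these corrections into elements of [C] ([fiber_exact_of_local]).

Conversely let f : Y -> C with [Y] in A_n, and suppose that the fibres are
acyclic. Then [f] is extended to larger and larger D_0-complexes, until the
domain is acyclic ([kill_all]). Let H be the top nonzero homology of [Y], a
family of modules H_i with maps lambda : H_i -> H_(i+1) and
alpha : H_(i+1) -> H_i (x) S. An element of H_m killed by both maps is a class
in the homotopy fibre of lambda : Ker alpha_m -> Ker alpha_(m+1) for [Y].
These classes are killed all at once by attaching T(F, m), where [F] is a
projective resolution of the top homology of that fibre ([resolution]); no new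
homology appears, and [f] extends because the fibre of [C] is acyclic and [F]
is bounded below. If lambda : H_(m-1) -> H_m is injective, so is its tensor
product with the flat module S, and lambda x = 0 implies
lambda (alpha x) = alpha (lambda x) = 0, hence alpha x = 0: the whole kernel of
lambda on H_m is killed ([kill_kernel]). Since H_0 = 0, this makes lambda
injective at m = 1, 2, ... in turn. At the last index where H is nonzero,
injectivity of lambda forces H_m = 0; so the range of indices shrinks until
H = 0 ([kill_degree]). Only finitely many homological degrees occur, since all
[Y i] are h-finite and acyclic for i >= n.

To work with cycles instead of homotopy fibres, [f] is first replaced by a map
that lifts pairs consisting of an element of the source tensored with S and a
compatible element of the target ([ample_replacement]). After this the cells of
T(F, m) above the index [m] can be left out ([attach]).
*)

Set Implicit Arguments.
Unset Strict Implicit.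
Unset Printing Implicit Defensive.

Import Order.TTheory GRing.Theory Num.Theory.
Local Open Scope ring_scope.
Local Open Scope quotient_scope.

(** * Linear maps and tensor products *)

Section Linear.
Variables (R : pzRingType) (U V : lmodType R).

Definition linear_of (f : U -> V) (f_lin : linear f) : {linear U -> V} :=
  HB.pack f (GRing.isLinear.Build R U V _ f f_lin).

End Linear.

Section LinearPairs.
Variables (R : pzRingType) (U V W : lmodType R).

Lemma pairl_linear (f : {linear U -> V}) (g : {linear U -> W}) :
  linear (fun x => (f x, g x)).
Proof. by move=> a x y; rewrite !linearP. Qed.
Definition pairl f g : {linear U -> (V * W)%type} := linear_of (pairl_linear f g).

Lemma copairl_linear (f : {linear U -> W}) (g : {linear V -> W}) :
  linear (fun x : (U * V)%type => f x.1 + g x.2).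
Proof.
by move=> a x y; rewrite !linearP scalerDr -!addrA; congr (_ + _); rewrite addrCA.
Qed.
Definition copairl f g : {linear (U * V)%type -> W} := linear_of (copairl_linear f g).

End LinearPairs.

Section Inject.
Variables (R : pzRingType) (U V : lmodType R).

Definition inl_lin : {linear U -> (U * V)%type} := pairl idfun \0.
Definition inr_lin : {linear V -> (U * V)%type} := pairl \0 idfun.

End Inject.

Section TensorMore.
Variables (R : pzRingType) (S : bimodule R).

Lemma tens_ext (M N : rmodType R) (h h' : {linear tensor S M -> N}) :
  (forall x y, h (tens x y) = h' (tens x y)) -> h =1 h'.
Proof.
move=> hh' u; rewrite (tensE u) !linear_sum; apply: eq_bigr => p _; exact: hh'.
Qed.

Lemma tens_map_comp (L M N : rmodType R) (g : {linear M -> N})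
    (f : {linear L -> M}) u :
  tens_map S g (tens_map S f u) = tens_map S (g \o f) u.
Proof.
pose h : {linear tensor S L -> tensor S N} := tens_map S g \o tens_map S f.
rewrite -[LHS]/(h u); move: u; apply: tens_ext => x y.
by rewrite /= !tens_map_tens.
Qed.

Lemma eq_tens_map (M N : rmodType R) (f g : {linear M -> N}) :
  f =1 g -> tens_map S f =1 tens_map S g.
Proof.
by move=> fg; apply: tens_ext => x y /=; rewrite !tens_map_tens fg.
Qed.

Lemma tens_map_id (M : rmodType R) (f : {linear M -> M}) :
  f =1 id -> tens_map S f =1 id.
Proof.
move=> fid u; pose h : {linear tensor S M -> tensor S M} := idfun.
rewrite -[RHS]/(h u); move: u; apply: tens_ext => x y.
by rewrite /= tens_map_tens fid.
Qed.

Section RightExact.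
Variables (A B D : rmodType R) (f : {linear A -> B}) (g : {linear B -> D}).
Hypothesis fg_exact : forall b, g b = 0 -> exists a, f a = b.
Hypothesis g_surj : forall d, exists b, g b = d.

Let lift (s : seq (B * S)) := [seq (g p.1, p.2) | p <- s].
Let im (u : tensor S B) := exists v, tens_map S f v = u.

Let im0 : im 0. Proof. by exists 0; rewrite linear0. Qed.
Let imD u v : im u -> im v -> im (u + v).
Proof. by move=> [a <-] [b <-]; exists (a + b); rewrite linearD. Qed.
Let imN u : im u -> im (- u).
Proof. by move=> [a <-]; exists (- a); rewrite linearN. Qed.
Let im_tens b y : g b = 0 -> im (tens b y).
Proof. by move=> /fg_exact[a <-]; exists (tens a y); rewrite tens_map_tens. Qed.

Let class_cons p s : tens_class (p :: s) = tens p.1 p.2 + tens_class s :> tensor S B.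
Proof. by case: p => x y; rewrite [RHS]tens_addE. Qed.

Let class_cat s t : tens_class (s ++ t) = tens_class s + tens_class t :> tensor S B.
Proof. by rewrite [RHS]tens_addE. Qed.

Let tensNl x y : - tens x y = tens (- x) y :> tensor S B.
Proof.
apply: (addrI (tens x y)); rewrite -tensDl !subrr.
apply: (addIr (tens 0 y)); by rewrite -tensDl add0r addr0.
Qed.

Let same_lift s t : lift s = lift t -> im (tens_class s - tens_class t).
Proof.
elim: s t => [|[b y] s IH] [|[b' y'] t] //=; first by rewrite subrr => _.
case=> gbb <- s_t; rewrite !class_cons /= opprD addrACA; apply: imD; last exact: IH.
by rewrite tensNl -tensDl; apply: im_tens; rewrite linearD linearN gbb subrr.
Qed.

Let lift_surj s : exists s', lift s' = s.
Proof.
elim: s => [|[d y] s [s' s'E]]; first by exists [::].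
by have [b bE] := g_surj d; exists ((b, y) :: s'); rewrite /= bE s'E.
Qed.

Let lift_cat s t u : lift u = s ++ t ->
  exists s' t', [/\ u = s' ++ t', lift s' = s & lift t' = t].
Proof.
move=> uE; exists (take (size s) u), (drop (size s) u).
split; first by rewrite cat_take_drop.
  by rewrite /lift map_take -/(lift u) uE take_size_cat.
by rewrite /lift map_drop -/(lift u) uE drop_size_cat.
Qed.

(* Two formal sums that represent the same element of D (x) S have lifts to
   B (x) S that differ by the image of f (x) S; checking this on each generator
   of the relation avoids the quotient of B (x) S by that image. *)
Let rel_im s t : tens_rel s t -> forall s' t', lift s' = s -> lift t' = t ->
  im (tens_class s' - tens_class t').
Proof.
elim=> {s t}.
- by move=> s s' t' <- /esym; exact: same_lift.
- by move=> s t _ IH s' t' s'E t'E; rewrite -opprB; apply/imN/IH.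
- move=> s t u _ IH1 _ IH2 s' u' s'E u'E; have [t' t'E] := lift_surj t.
  rewrite -(subrKA (tens_class t')); exact: imD (IH1 _ _ s'E t'E) (IH2 _ _ t'E u'E).
- move=> s s1 t t1 _ IH1 _ IH2 u v /lift_cat[s' [t' [-> s'E t'E]]].
  move=> /lift_cat[s1' [t1' [-> s1'E t1'E]]].
  by rewrite !class_cat opprD addrACA; apply: imD; [apply: IH1|apply: IH2].
- move=> s t u v /lift_cat[s' [t' [-> s'E t'E]]].
  move=> /lift_cat[t1' [s1' [-> t1'E s1'E]]].
  rewrite !class_cat [tens_class t1' + _]addrC opprD addrACA.
  by apply: imD; apply: same_lift; rewrite ?s'E ?t'E.
- move=> y [|[b y'] [|? ?]] // [|? ?] //= [gb yE] _.
  by rewrite subr0; apply: im_tens.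
- move=> x x' y [|[b y'] [|? ?]] // [|[b1 y1] [|[b2 y2] [|? ?]]] //=.
  move=> [gb ->] [gb1 -> gb2 ->]; rewrite !class_cons /= !addr0.
  rewrite opprD !tensNl -!tensDl; apply: im_tens.
  by rewrite !(linearD, linearN) gb gb1 gb2 -opprD subrr.
- move=> x y y1 [|[b y'] [|? ?]] // [|[b1 y1'] [|[b2 y2] [|? ?]]] //=.
  move=> [gb ->] [gb1 -> gb2 ->]; rewrite !class_cons /= !addr0.
  rewrite tensDr opprD addrACA !tensNl -!tensDl; apply: imD; apply: im_tens;
    by rewrite !(linearD, linearN) gb ?gb1 ?gb2 subrr.
- move=> x r y [|[b y'] [|? ?]] // [|[b1 y1'] [|? ?]] //=.
  move=> [gb ->] [gb1 ->]; rewrite !class_cons /= !addr0.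
  rewrite -tens_lact tensNl -tensDl; apply: im_tens.
  by rewrite linearD linearN linearZ gb gb1 subrr.
Qed.

(** For surjective [g] only: the general case needs flatness and goes through
the image of [g]. *)
Lemma tens_right_exact u : tens_map S g u = 0 -> exists v, tens_map S f v = u.
Proof.
move=> gu0; rewrite -(tens_class_repr u) -[tens_class _]subr0.
apply: (@rel_im (lift (repr u)) [::]) => //.
by apply/tens_classP; rewrite -[LHS]/(tens_map S g u) gu0.
Qed.

End RightExact.

End TensorMore.

Section Image.
Variables (R : pzRingType) (U V : lmodType R) (f : {linear U -> V}).

Definition image_pred : {pred V} := fun y => `[< exists x, f x = y >].

Lemma image_pred_closed : submod_closed image_pred.
Proof.
split=> [|a x y]; first by apply/asboolP; exists 0; rewrite linear0.
move=> /asboolP[x' <-] /asboolP[y' <-].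
by apply/asboolP; exists (a *: x' + y'); rewrite linearP.
Qed.

HB.instance Definition _ := GRing.isSubmodClosed.Build R V image_pred
  image_pred_closed.

Record lin_image := LinImage { image_val : V; image_valP : image_val \in image_pred }.

HB.instance Definition _ := [isSub for image_val].
HB.instance Definition _ := [Choice of lin_image by <:].
HB.instance Definition _ := [SubChoice_isSubLmodule of lin_image by <:].

Lemma to_image_subproof x : f x \in image_pred.
Proof. by apply/asboolP; exists x. Qed.

Lemma to_image_linear : linear (fun x => LinImage (to_image_subproof x)).
Proof. by move=> a x y; apply: val_inj; rewrite /= linearP. Qed.
Definition to_image : {linear U -> lin_image} := linear_of to_image_linear.

Lemma image_incl_linear : linear image_val.
Proof. by move=> a x y; rewrite -[image_val (_ + _)]/(val _) !linearP. Qed.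
Definition image_incl : {linear lin_image -> V} := linear_of image_incl_linear.

End Image.

Section Flat.
Variables (R : pzRingType) (S : bimodule R).
Hypothesis S_flat : flat_on_left S.

(** Factor [g] through its image: the surjective part is handled by right
exactness, the inclusion of the image stays injective by flatness. *)
Lemma flat_exact (A B D : rmodType R) (f : {linear A -> B}) (g : {linear B -> D}) :
  (forall b, g b = 0 -> exists a, f a = b) ->
  forall u, tens_map S g u = 0 -> exists v, tens_map S f v = u.
Proof.
move=> fg_exact u gu0; apply: (@tens_right_exact R S A B _ f (to_image g)).
- by move=> b /(congr1 val) /= /fg_exact.
- by move=> [d dP]; have /asboolP[b bE] := dP; exists b; apply: val_inj.
apply: (@S_flat _ _ (image_incl g)); first by move=> x y /val_inj.
by rewrite linear0 tens_map_comp -[RHS]gu0; apply: eq_tens_map.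
Qed.

End Flat.

(** * Free modules *)

Section Free.
Variable R : pzRingType.

Inductive word (A : Type) :=
| WZero | WGen of A | WOpp of word A | WAdd of word A & word A
| WScale of R^c & word A.

Variable A : Type.

Fixpoint weval (N : rmodType R) (e : A -> N) (w : word A) : N :=
  match w with
  | WZero => 0
  | WGen a => e a
  | WOpp v => - weval e v
  | WAdd u v => weval e u + weval e v
  | WScale r v => r *: weval e v
  end.

(** Two words are identified when all evaluations in all modules agree. The
module axioms and the universal property then hold because they hold in each
module of values. *)
Definition same_value (u v : word A) : bool :=
  `[< forall (N : rmodType R) (e : A -> N), weval e u = weval e v >].

Lemma same_value_refl : reflexive same_value.
Proof. by move=> u; apply/asboolP. Qed.
Lemma same_value_sym : symmetric same_value.
Proof. by move=> u v; apply/asboolP/asboolP => uv N e; rewrite uv. Qed.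
Lemma same_value_trans : transitive same_value.
Proof.
by move=> v u w /asboolP uv /asboolP vw; apply/asboolP => N e; rewrite uv.
Qed.

HB.instance Definition _ := gen_eqMixin (word A).
HB.instance Definition _ := gen_choiceMixin (word A).

Canonical same_value_equiv := EquivRel same_value same_value_refl same_value_sym same_value_trans.

Definition free := {eq_quot same_value_equiv}.
HB.instance Definition _ := Choice.on free.
HB.instance Definition _ := EqQuotient.on free.

Definition fword (w : word A) : free := \pi_free w.

Lemma fwordP u v : fword u = fword v <->
  forall (N : rmodType R) (e : A -> N), weval e u = weval e v.
Proof. by split=> [/eqmodP/asboolP//|uv]; apply/eqmodP/asboolP. Qed.

Lemma fword_eq u v : (forall (N : rmodType R) (e : A -> N),
  weval e u = weval e v) -> fword u = fword v.
Proof. by move/fwordP. Qed.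

Lemma fword_repr (x : free) : fword (repr x) = x.
Proof. exact: reprK. Qed.

Lemma weval_repr (N : rmodType R) (e : A -> N) w :
  weval e (repr (fword w)) = weval e w.
Proof. by have /fwordP := fword_repr (fword w); apply. Qed.

Definition free_add (x y : free) := fword (WAdd (repr x) (repr y)).
Definition free_opp (x : free) := fword (WOpp (repr x)).
Definition free_scale (r : R^c) (x : free) := fword (WScale r (repr x)).

Lemma free_addA : associative free_add.
Proof. by move=> x y z; apply: fword_eq => N e; rewrite /= !weval_repr /= addrA. Qed.
Lemma free_addC : commutative free_add.
Proof. by move=> x y; apply: fword_eq => N e; rewrite /= addrC. Qed.
Lemma free_add0 : left_id (fword (WZero A)) free_add.
Proof.
move=> x; rewrite -[RHS]fword_repr; apply: fword_eq => N e.
by rewrite /= weval_repr add0r.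
Qed.
Lemma free_addN : left_inverse (fword (WZero A)) free_opp free_add.
Proof. by move=> x; apply: fword_eq => N e; rewrite /= weval_repr /= addNr. Qed.

HB.instance Definition _ := GRing.isZmodule.Build free
  free_addA free_addC free_add0 free_addN.

Lemma free_scaleA a b x : free_scale a (free_scale b x) = free_scale (a * b) x.
Proof. by apply: fword_eq => N e; rewrite /= !weval_repr /= scalerA. Qed.
Lemma free_scale1 : left_id 1 free_scale.
Proof.
move=> x; rewrite -[RHS]fword_repr; apply: fword_eq => N e.
by rewrite /= scale1r.
Qed.
Lemma free_scaleDr : right_distributive free_scale +%R.
Proof.
by move=> a x y; apply: fword_eq => N e; rewrite /= !weval_repr /= scalerDr.
Qed.
Lemma free_scaleDl x : {morph free_scale^~ x : a b / a + b}.
Proof.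
by move=> a b; apply: fword_eq => N e; rewrite /= !weval_repr /= scalerDl.
Qed.

HB.instance Definition _ := GRing.Zmodule_isLmodule.Build R^c free
  free_scaleA free_scale1 free_scaleDr free_scaleDl.

Definition gen (a : A) : free := fword (WGen a).

Section Extension.
Variables (N : rmodType R) (e : A -> N).

Lemma free_ext_linear : linear (fun x : free => weval e (repr x)).
Proof. by move=> a x y; rewrite weval_repr /= weval_repr. Qed.

Lemma free_ext_subproof : {h : {linear free -> N} | forall a, h (gen a) = e a}.
Proof. by exists (linear_of free_ext_linear) => a; exact: weval_repr. Qed.
Definition free_ext : {linear free -> N} := sval free_ext_subproof.

Lemma free_ext_gen a : free_ext (gen a) = e a.
Proof. exact: (svalP free_ext_subproof). Qed.

End Extension.

Lemma free_ind (P : free -> Prop) :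
  P 0 -> (forall a, P (gen a)) -> (forall x, P x -> P (- x)) ->
  (forall x y, P x -> P y -> P (x + y)) -> (forall r x, P x -> P (r *: x)) ->
  forall x, P x.
Proof.
move=> P0 Pg PN PD PZ x; rewrite -(fword_repr x).
elim: (repr x) => [|a|u IH|u IHu v IHv|r u IH]; first exact: P0; first exact: Pg.
- suff -> : fword (WOpp u) = - fword u by apply: PN.
  by apply: fword_eq => N e; rewrite /= weval_repr.
- suff -> : fword (WAdd u v) = fword u + fword v by apply: PD.
  by apply: fword_eq => N e; rewrite /= !weval_repr.
- suff -> : fword (WScale r u) = r *: fword u by apply: PZ.
  by apply: fword_eq => N e; rewrite /= weval_repr.
Qed.

Lemma eq_free (N : rmodType R) (h h' : {linear free -> N}) :
  (forall a, h (gen a) = h' (gen a)) -> h =1 h'.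
Proof.
move=> hh'; apply: free_ind => [|//|x hx|x y hx hy|r x hx].
- by rewrite !linear0.
- by rewrite !linearN hx.
- by rewrite !linearD hx hy.
- by rewrite !linearZ /= hx.
Qed.

Lemma free_projective : projective free.
Proof.
move=> M N p f p_surj.
have [c cE] := boolp.choice (fun a => p_surj (f (gen a))).
exists (free_ext c) => x.
pose h : {linear free -> N} := p \o free_ext c.
rewrite -[LHS]/(h x); move: x; apply: eq_free => a.
by rewrite [LHS]/= free_ext_gen.
Qed.

End Free.

Arguments gen R {A} a.

Section Projectives.
Variable R : pzRingType.

Lemma projective_pair (P Q : rmodType R) :
  projective P -> projective Q -> projective (P * Q)%type.
Proof.
move=> Pp Qp M N p f p_surj.
have [g gE] := Pp M N p (f \o inl_lin P Q) p_surj.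
have [h hE] := Qp M N p (f \o inr_lin P Q) p_surj.
exists (copairl g h) => -[x y].
have -> : (x, y) = inl_lin P Q x + inr_lin P Q y.
  by congr (_, _); rewrite /= ?addr0 ?add0r.
have gE' : p (g x) = f (inl_lin P Q x) := gE x.
have hE' : p (h y) = f (inr_lin P Q y) := hE y.
by rewrite [RHS]linearD -gE' -hE' -linearD /= addr0 add0r.
Qed.

Lemma projective_trivial (P : rmodType R) :
  (forall x : P, x = 0) -> projective P.
Proof. by move=> P0 M N p f _; exists \0 => x; rewrite (P0 x) !linear0. Qed.

End Projectives.

(** * Resolutions of truncated complexes *)

Section ExactAt.
Variable R : pzRingType.

(** Vanishing of the homology in degree [k + 1]. *)
Definition exact_at (C : complex R) (k : int) :=
  forall x : C (k + 1), diff C k x = 0 -> exists z, diff C (k + 1) z = x.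

Lemma acyclicP (C : complex R) : acyclic C <-> forall k, exact_at C k.
Proof.
split=> CE k x dx; have [z zE] := CE k x dx; exists z; by rewrite ?subr0 // zE subr0.
Qed.

Definition zero_mod : rmodType R := free R void.

Lemma zero_mod_eq0 (x : zero_mod) : x = 0.
Proof.
move: x; apply: free_ind => // [x ->|x y -> ->|r x ->].
- exact: oppr0.
- exact: addr0.
- exact: scaler0.
Qed.

End ExactAt.

Section Resolution.
Variables (R : pzRingType) (A : complex R) (Q : forall k, A k -> Prop) (c : int).

(** The top of a resolution built so far: a module [smod] in degree [sdeg],
its map [smap] to [A] and its differential [sdiff]. *)
Record stage := Stage {
  sdeg : int;
  smod : rmodType R;
  smap : {linear smod -> A sdeg};
  sprev : rmodType R;
  sdiff : {linear smod -> sprev} }.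

(** The generators one degree higher: a cycle of the resolution together with
an element of [A] that bounds its image. *)
Definition lifting (s : stage) := {p : smod s * A (sdeg s + 1) |
  [/\ sdiff s p.1 = 0, diff A (sdeg s) p.2 = smap s p.1 & Q p.2]}.

Definition next_stage (s : stage) : stage :=
  @Stage (sdeg s + 1) (free R (lifting s)) (free_ext (fun p => (sval p).2))
    (smod s) (free_ext (fun p => (sval p).1)).

(** Stage 0 is the zero module in degree [c], so that the generators of stage 1
are the cycles of [A] in degree [c + 1] that satisfy [Q]. *)
Fixpoint stage_at j : stage :=
  if j is i.+1 then next_stage (stage_at i)
  else @Stage c (zero_mod R) \0 (zero_mod R) \0.

Notation H j := (smod (stage_at j)).
Notation e j := (sdeg (stage_at j)).
Notation t j := (smap (stage_at j)).
Notation del j := (sdiff (stage_at j.+1) : {linear H j.+1 -> H j}).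

Lemma sdegE j : e j = c + j%:Z.
Proof. by elim: j => [|j IH] /=; [rewrite addr0 | rewrite IH; lia]. Qed.

Lemma smap_del j x : diff A (e j) (t j.+1 x) = t j (del j x).
Proof.
pose h : {linear H j.+1 -> A (e j)} := diff A (e j) \o t j.+1.
pose h' : {linear H j.+1 -> A (e j)} := t j \o del j.
rewrite -[LHS]/(h x) -[RHS]/(h' x); move: x; apply: eq_free => -[p pP].
by rewrite /= !free_ext_gen /=; case: pP.
Qed.

Lemma sdiff_del j x : sdiff (stage_at j) (del j x) = 0.
Proof.
pose h : {linear H j.+1 -> sprev (stage_at j)} := sdiff (stage_at j) \o del j.
rewrite -[LHS]/(h x) -[RHS]/((\0 : {linear H j.+1 -> sprev (stage_at j)}) x).
move: x; apply: eq_free => -[p pP].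
by rewrite /= !free_ext_gen /=; case: pP.
Qed.

(** The differential between two stages, extended by zero to stages that are
not consecutive. With an arbitrary pair of stage numbers as arguments, no
transport along equations between degrees is needed to iterate it. *)
Definition rdiff p q : {linear H p -> H q} :=
  match @eqP nat q.+1 p with
  | ReflectT E => eq_rect q.+1 (fun p => {linear H p -> H q}) (del q) p E
  | ReflectF _ => \0
  end.

Lemma rdiffE q : rdiff q.+1 q = del q.
Proof.
by rewrite /rdiff; case: eqP => // E; rewrite (eq_irrelevance E erefl).
Qed.

Lemma rdiff0 p q : q.+1 <> p -> rdiff p q = \0.
Proof. by rewrite /rdiff; case: eqP. Qed.

Lemma rdiffK p q r x : rdiff q r (rdiff p q x) = 0.
Proof.
have [E|/eqP/rdiff0->] := eqVneq q.+1 p; last by rewrite linear0.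
have [E'|/eqP/rdiff0->//] := eqVneq r.+1 q.
by subst p q; rewrite !rdiffE sdiff_del.
Qed.

Definition rto p k : {linear H p -> A k} :=
  match @eqP int (e p) k with
  | ReflectT E => eq_rect (e p) (fun k => {linear H p -> A k}) (t p) k E
  | ReflectF _ => \0
  end.

Lemma rtoE p : rto p (e p) = t p.
Proof.
by rewrite /rto; case: eqP => // E; rewrite (eq_irrelevance E erefl).
Qed.

Lemma rto_vanish p k (N : rmodType R) (psi : {linear A k -> N}) :
  (forall x, Q x -> psi x = 0) -> forall g, psi (rto p k g) = 0.
Proof.
move=> psi0; rewrite /rto; case: eqP => [E|_] g; last by rewrite linear0.
move: psi psi0; case: k / E => psi psi0 /=.
move: psi psi0 g; case: p => [|p] psi psi0 g; first by rewrite linear0.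
pose h : {linear H p.+1 -> N} := psi \o t p.+1.
rewrite -[LHS]/(h g) -[RHS]/((\0 : {linear H p.+1 -> N}) g).
move: g; apply: eq_free => -[x xP].
rewrite /= !free_ext_gen /=; case: xP => _ _ Qx; exact: psi0.
Qed.

Lemma stage0_eq0 p (x : H p) : p = 0%N -> x = 0.
Proof. by move=> p0; subst p; exact: zero_mod_eq0. Qed.

Lemma rto_diff p j k x : p = j.+1 -> e j = k ->
  diff A k (rto p (k + 1) x) = rto j k (rdiff p j x).
Proof.
move=> pE kE; subst p k; rewrite rtoE rdiffE -[e j + 1]/(e j.+1) rtoE.
exact: smap_del.
Qed.

Lemma rdiff_lift p j q k (g : H j) (x : A (k + 1)) :
    p = j.+1 -> e j = k -> j = q.+1 \/ j = 0%N ->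
    rdiff j q g = 0 -> diff A k x = rto j k g -> Q x ->
  exists g' : H p, rdiff p j g' = g /\ rto p (k + 1) g' = x.
Proof.
move=> pE kE jE g0 xg Qx; subst p k; rewrite rtoE in xg.
have dg0 : sdiff (stage_at j) g = 0.
  by case: jE => jE; subst j; [rewrite rdiffE in g0 | ].
have Hp : [/\ sdiff (stage_at j) (g, x).1 = 0, diff A (e j) (g, x).2 = t j (g, x).1
  & Q (g, x).2] by [].
exists (gen R (exist _ (g, x) Hp : lifting (stage_at j))).
by rewrite rdiffE -[e j + 1]/(e j.+1) rtoE /= !free_ext_gen.
Qed.

Definition pos_part (k : int) : nat := if k is Posz j then j else 0%N.

(** The stage that sits in degree [k] of the shifted resolution below; stage 0,
the zero module, serves all degrees up to [c + 1]. *)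
Let u (k : int) := pos_part (k - (c + 1)).

Let uS (k : int) : c <= k -> e (u (k + 1)) = k.
Proof.
move=> ck; rewrite sdegE /u.
by have [j ->] : exists j : nat, k = c + j%:Z;
  [exists `|k - c|%N; lia | rewrite (_ : _ - _ = j%:Z) //; lia].
Qed.

Let u0 (k : int) : k <= c + 1 -> u k = 0%N.
Proof. by rewrite /u /pos_part; case E: (k - (c + 1)) => [j|j] kc //; lia. Qed.

Let uSS (k : int) : c + 1 <= k -> u (k + 1) = (u k).+1.
Proof.
rewrite /u => ck; have [j ->] : exists j : nat, k = c + 1 + j%:Z.
  by exists (absz (k - (c + 1))%R); lia.
rewrite (_ : _ - _ = j.+1%:Z); last by lia.
by rewrite (_ : _ - _ = j%:Z) //; lia.
Qed.

Definition res_complex : complex R :=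
  @Complex R (fun k => H (u k)) (fun k => rdiff (u (k + 1)) (u k))
    (fun k x => @rdiffK _ _ _ x).

(** A projective resolution, shifted up by one degree, of the part of [A] in
degrees above [c]. The elements of [A] that are hit are restricted by the linear
conditions [Q]; these hold on the whole image of [tau] since each linear map
that vanishes on [Q] vanishes on it. The last clause is exactness of the mapping
cone of [tau] in its sharpest form: the lift [g'] has the prescribed boundary
and the prescribed image, because such pairs were the generators. *)
Theorem resolution : exists (G : complex R) (tau : forall k, {linear G (k + 1) -> A k}),
  [/\ projective_complex G, forall k (x : G k), k <= c + 1 -> x = 0,
      forall k x, diff A k (tau (k + 1) x) = tau k (diff G (k + 1) x),
      forall k (N : rmodType R) (psi : {linear A k -> N}),
        (forall x, Q x -> psi x = 0) -> forall g, psi (tau k g) = 0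
    & forall k (g : G (k + 1)) (x : A (k + 1)), c <= k ->
        diff G k g = 0 -> diff A k x = tau k g -> Q x ->
      exists g', diff G (k + 1) g' = g /\ tau (k + 1) g' = x].
Proof.
exists res_complex, (fun k => rto (u (k + 1)) k); split.
- by move=> k /=; case: (u k) => [|j]; exact: free_projective.
- by move=> k x kc; apply/stage0_eq0/u0.
- move=> k x; have [ck|kc] := leP c k.
    by apply: rto_diff; [apply: uSS; lia | apply: uS].
  by rewrite (stage0_eq0 x) ?linear0 //; apply: u0; lia.
- by move=> k N psi psi0 g; exact: rto_vanish.
- move=> k g x ck dg xg Qx; apply: (rdiff_lift _ _ _ dg) => //.
  + by apply: uSS; lia.
  + exact: uS.
  + have [kc|ck1] := eqVneq k c; first by right; apply: u0; lia.
    by left; apply: uSS; lia.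
Qed.

End Resolution.

(** * Ample replacement of a map *)

Section ProductComplex.
Variable R : pzRingType.
Implicit Types A B M : complex R.

Definition prod_diff A B (k : int) : {linear (A (k + 1)%R * B (k + 1)%R)%type -> (A k * B k)%type} :=
  pairl (diff A k \o fst) (diff B k \o snd).

Lemma prod_diffK A B k x : prod_diff A B k (prod_diff A B (k + 1) x) = 0.
Proof. by rewrite /= !diffK. Qed.

Definition prod_complex A B : complex R :=
  @Complex R (fun k => (A k * B k)%type) (prod_diff A B) (@prod_diffK A B).

Lemma copair_comm A B M (f : chain_map A M) (g : chain_map B M) k x :
  copairl (f k) (g k) (diff (prod_complex A B) k x) =
  diff M k (copairl (f (k + 1)) (g (k + 1)) x).
Proof. by rewrite /= !chain_comm linearD. Qed.

Definition chain_copair A B M (f : chain_map A M) (g : chain_map B M) :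
    chain_map (prod_complex A B) M :=
  @ChainMap R (prod_complex A B) M (fun k => copairl (f k) (g k)) (copair_comm f g).

Lemma inl_comm A B k x :
  inl_lin (A k) (B k) (diff A k x) =
  diff (prod_complex A B) k (inl_lin (A (k + 1)) (B (k + 1)) x).
Proof. by rewrite /= linear0. Qed.

Definition chain_inl A B : chain_map A (prod_complex A B) :=
  @ChainMap R A (prod_complex A B) (fun k => inl_lin (A k) (B k)) (@inl_comm A B).

Lemma inr_comm A B k x :
  inr_lin (A k) (B k) (diff B k x) =
  diff (prod_complex A B) k (inr_lin (A (k + 1)) (B (k + 1)) x).
Proof. by rewrite /= linear0. Qed.

Definition chain_inr A B : chain_map B (prod_complex A B) :=
  @ChainMap R B (prod_complex A B) (fun k => inr_lin (A k) (B k)) (@inr_comm A B).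

Definition chain_fst A B : chain_map (prod_complex A B) A :=
  @ChainMap R (prod_complex A B) A (fun k => fst) (fun k x => erefl).

Lemma eq_on_pairs (U V W : rmodType R) (h h' : {linear (U * V)%type -> W}) :
  (forall x, h (x, 0) = h' (x, 0)) -> (forall y, h (0, y) = h' (0, y)) -> h =1 h'.
Proof.
move=> hl hr [x y]; have -> : (x, y) = (x, 0) + (0, y).
  by congr (_, _); rewrite /= ?addr0 ?add0r.
by rewrite !linearD hl hr.
Qed.

End ProductComplex.

(** The contractible complex generated by a graded set: each generator [v]
contributes [v] and its boundary. A chain map out of it amounts to a map of
graded sets, so all generators can be chosen element by element. *)
Section Disc.
Variables (R : pzRingType).

Section DiscComplex.
Variable V : int -> Type.

Definition disc_diff (k : int) : {linear (free R (V (k + 1)%R) * free R (V (k + 1 + 1)%R))%type ->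
    (free R (V k) * free R (V (k + 1)%R))%type} := inr_lin _ _ \o fst.

Lemma disc_diffK k x : disc_diff k (disc_diff (k + 1) x) = 0.
Proof. by []. Qed.

Definition disc : complex R :=
  @Complex R (fun k => (free R (V k) * free R (V (k + 1)%R))%type) disc_diff disc_diffK.

Definition disc_gen k (v : V k) : disc k := (gen R v, 0).

Lemma disc_exact k : exact_at disc k.
Proof. by move=> [p p'] /= [->]; exists (p', 0). Qed.

Lemma disc_projective : projective_complex disc.
Proof. by move=> k; apply: projective_pair; exact: free_projective. Qed.

Section Ext.
Variables (M : complex R) (e : forall k, V k -> M k).

Definition disc_ext_fun k : {linear disc k -> M k} :=
  copairl (free_ext (e (k:=k))) (diff M k \o free_ext (e (k:=k + 1))).

Lemma disc_ext_comm k x :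
  disc_ext_fun k (diff disc k x) = diff M k (disc_ext_fun (k + 1) x).
Proof. by rewrite /= linear0 add0r linearD diffK addr0. Qed.

Lemma disc_ext_subproof :
  {h : chain_map disc M | forall k (v : V k), h k (disc_gen v) = e v}.
Proof.
exists (ChainMap disc_ext_comm) => k v.
by rewrite /= free_ext_gen !linear0 addr0.
Qed.

Definition disc_ext : chain_map disc M := sval disc_ext_subproof.

Lemma disc_ext_gen k (v : V k) : disc_ext k (disc_gen v) = e v.
Proof. exact: (svalP disc_ext_subproof). Qed.

End Ext.

Lemma eq_disc (M : complex R) (f g : chain_map disc M) :
  (forall k v, f k (disc_gen v) = g k (disc_gen v)) -> forall k, f k =1 g k.
Proof.
move=> fg; have fgl k (p : free R (V k)) : f k (p, 0) = g k (p, 0).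
  pose h (f : chain_map disc M) : {linear free R (V k) -> M k} :=
    f k \o inl_lin _ (free R (V (k + 1))).
  rewrite -[LHS]/(h f p) -[RHS]/(h g p); move: p; apply: eq_free => v.
  exact: fg.
move=> k; apply: eq_on_pairs => [|p']; first exact: fgl.
have -> : (0, p') = diff disc k (p', 0) by [].
by rewrite !chain_comm fgl.
Qed.

End DiscComplex.
End Disc.

Arguments disc_gen : simpl never.

Section Ample.
Variables (R : pzRingType) (S : bimodule R).

(** With [C] reduced this makes [X] reduced (take any [c] above the image of
[y]) and makes the maps between the kernels of alpha surjective (take
[y = 0]). *)
Definition ample (X C : D0_complex S) (f : D0_map X C) :=
  forall i k (y : tensor S (X i k)) (c : C i.+1 k),
    d0_alpha C i k c = tens_map S (f i k) y ->
  exists x : X i.+1 k, d0_alpha X i k x = y /\ f i.+1 k x = c.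

Variables (Y C : D0_complex S) (f : D0_map Y C).

(** Generators to be added at index [i], with their values in [C i]. *)
Record cell_set i := CellSet {
  cs_sort : int -> Type;
  cs_val : forall k, cs_sort k -> C i k }.

(** The generators enter as a contractible summand, which leaves the homology
unchanged. *)
Definition lv_complex i (s : cell_set i) : complex R :=
  prod_complex (Y i) (disc R (cs_sort s)).

Definition lv_inl i (s : cell_set i) : chain_map (Y i) (lv_complex s) :=
  chain_inl (Y i) (disc R (cs_sort s)).

Definition lv_inr i (s : cell_set i) : chain_map (disc R (cs_sort s)) (lv_complex s) :=
  chain_inr (Y i) (disc R (cs_sort s)).

Lemma eq_lv i (s : cell_set i) (M : complex R) (F G : chain_map (lv_complex s) M) :
  (forall k y, F k (lv_inl s k y) = G k (lv_inl s k y)) ->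
  (forall k v, F k (lv_inr s k (disc_gen R v)) = G k (lv_inr s k (disc_gen R v))) ->
  forall k x, F k x = G k x.
Proof.
move=> FGl FGr k; apply: eq_on_pairs => [y|v]; first exact: FGl.
exact: (eq_disc (f := chain_comp F (lv_inr s)) (g := chain_comp G (lv_inr s)) FGr).
Qed.

Section Out.
Variables (i : nat) (s : cell_set i) (M : complex R) (a : chain_map (Y i) M)
  (e : forall k, cs_sort s k -> M k).

Lemma lv_out_subproof : {h : chain_map (lv_complex s) M |
  (forall k y, h k (lv_inl s k y) = a k y) /\
  (forall k v, h k (lv_inr s k (disc_gen R v)) = e v)}.
Proof.
exists (chain_copair a (disc_ext e)); split=> k y /=.
  by rewrite linear0 addr0.
by rewrite linear0 add0r disc_ext_gen.
Qed.

Definition lv_out : chain_map (lv_complex s) M := sval lv_out_subproof.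

Lemma lv_out_inl k y : lv_out k (lv_inl s k y) = a k y.
Proof. exact: (svalP lv_out_subproof).1. Qed.

Lemma lv_out_gen k v : lv_out k (lv_inr s k (disc_gen R v)) = e v.
Proof. exact: (svalP lv_out_subproof).2. Qed.

End Out.

Definition lv_map i (s : cell_set i) : chain_map (lv_complex s) (C i) :=
  lv_out (f i) (@cs_val _ s).

(** The generators at index [i.+1] are all the pairs that an ample map has to
lift: an element of the tensored level [i] and a compatible element of
[C i.+1]. Taking all pairs, and not one lift for each element, makes the
construction functorial in lambda. *)
Definition lv_next i (s : cell_set i) : cell_set i.+1 := @CellSet i.+1
  (fun k => {p : tensor S (lv_complex s k) * C i.+1 k |
     d0_alpha C i k p.2 = tens_map S (lv_map s k) p.1})
  (fun k p => (sval p).2).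

Definition cell_map i (s : cell_set i) (s' : cell_set i.+1) :=
  {L : forall k, cs_sort s k -> cs_sort s' k |
   forall k v, cs_val (L k v) = d0_lambda C i k (cs_val v)}.

Definition lv_lambda i (s : cell_set i) (s' : cell_set i.+1) (L : cell_map s s') :
    chain_map (lv_complex s) (lv_complex s') :=
  lv_out (chain_comp (lv_inl s') (d0_lambda Y i))
    (fun k v => lv_inr s' k (disc_gen R (sval L k v))).

Definition lv_alpha i (s : cell_set i) :
    chain_map (lv_complex (lv_next s)) (tens_complex S (lv_complex s)) :=
  lv_out (chain_comp (tens_chain S (lv_inl s)) (d0_alpha Y i))
    (fun k (p : cs_sort (lv_next s) k) => (sval p).1 : tens_complex S (lv_complex s) k).

Lemma lv_map_inl i (s : cell_set i) k y : lv_map s k (lv_inl s k y) = f i k y.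
Proof. exact: lv_out_inl. Qed.

Lemma lv_map_gen i (s : cell_set i) k v :
  lv_map s k (lv_inr s k (disc_gen R v)) = cs_val v.
Proof. exact: lv_out_gen. Qed.

Lemma lv_lambda_inl i (s : cell_set i) (s' : cell_set i.+1) (L : cell_map s s') k y :
  lv_lambda L k (lv_inl s k y) = lv_inl s' k (d0_lambda Y i k y).
Proof. exact: lv_out_inl. Qed.

Lemma lv_lambda_gen i (s : cell_set i) (s' : cell_set i.+1) (L : cell_map s s') k v :
  lv_lambda L k (lv_inr s k (disc_gen R v)) = lv_inr s' k (disc_gen R (sval L k v)).
Proof. exact: lv_out_gen. Qed.

Lemma lv_alpha_inl i (s : cell_set i) k y :
  lv_alpha s k (lv_inl (lv_next s) k y) = tens_map S (lv_inl s k) (d0_alpha Y i k y).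
Proof. exact: lv_out_inl. Qed.

Lemma lv_alpha_gen i (s : cell_set i) k (v : cs_sort (lv_next s) k) :
  lv_alpha s k (lv_inr (lv_next s) k (disc_gen R v)) = (sval v).1.
Proof. exact: lv_out_gen. Qed.

Local Opaque lv_complex lv_map lv_lambda lv_alpha lv_inl lv_inr.

Lemma lv_map_lambda i (s : cell_set i) (s' : cell_set i.+1) (L : cell_map s s') k x :
  lv_map s' k (lv_lambda L k x) = d0_lambda C i k (lv_map s k x).
Proof.
move: k x; apply: (eq_lv (F := chain_comp (lv_map s') (lv_lambda L))
  (G := chain_comp (d0_lambda C i) (lv_map s))) => k v /=.
  by rewrite lv_lambda_inl !lv_map_inl d0_fun_lambda.
by rewrite lv_lambda_gen !lv_map_gen (svalP L).
Qed.

Lemma lv_map_alpha i (s : cell_set i) k x :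
  tens_chain S (lv_map s) k (lv_alpha s k x) =
  d0_alpha C i k (lv_map (lv_next s) k x).
Proof.
move: k x; apply: (eq_lv (F := chain_comp (tens_chain S (lv_map s)) (lv_alpha s))
  (G := chain_comp (d0_alpha C i) (lv_map (lv_next s)))) => k v /=.
  rewrite lv_alpha_inl lv_map_inl -d0_fun_alpha /= tens_map_comp.
  by apply: eq_tens_map => z; apply: lv_map_inl.
by rewrite lv_alpha_gen lv_map_gen; apply/esym/(svalP v).
Qed.

Lemma cell_map_next_subproof i (s : cell_set i) (s' : cell_set i.+1)
    (L : cell_map s s') k (p : cs_sort (lv_next s) k) :
  d0_alpha C i.+1 k (d0_lambda C i.+1 k (sval p).2) =
  tens_map S (lv_map s' k) (tens_map S (lv_lambda L k) (sval p).1).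
Proof.
rewrite d0_comm (svalP p) [LHS]/= !tens_map_comp; apply: eq_tens_map => x.
exact/esym/lv_map_lambda.
Qed.

Definition cell_map_next i (s : cell_set i) (s' : cell_set i.+1)
    (L : cell_map s s') : cell_map (lv_next s) (lv_next s') :=
  exist _ (fun k (p : cs_sort (lv_next s) k) =>
     exist _ (tens_map S (lv_lambda L k) (sval p).1,
              d0_lambda C i.+1 k (sval p).2) (cell_map_next_subproof L p) :
       cs_sort (lv_next s') k)
    (fun k p => erefl).

Lemma lv_comm i (s : cell_set i) (s' : cell_set i.+1) (L : cell_map s s') k x :
  lv_alpha s' k (lv_lambda (cell_map_next L) k x) =
  tens_chain S (lv_lambda L) k (lv_alpha s k x).
Proof.
move: k x; apply: (eq_lv (F := chain_comp (lv_alpha s') (lv_lambda (cell_map_next L)))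
  (G := chain_comp (tens_chain S (lv_lambda L)) (lv_alpha s))) => k v /=.
  rewrite lv_lambda_inl !lv_alpha_inl d0_comm /= !tens_map_comp.
  by apply: eq_tens_map => z; apply/esym/lv_lambda_inl.
by rewrite lv_lambda_gen !lv_alpha_gen.
Qed.

Local Transparent lv_complex.

Lemma lv_proj i (s : cell_set i) : projective_complex (lv_complex s).
Proof.
by move=> k; apply: projective_pair; [exact: d0_proj | exact: disc_projective].
Qed.

Fixpoint cells_at i : cell_set i :=
  if i is j.+1 then lv_next (cells_at j) else @CellSet 0 (fun _ => void)
    (fun k v => match v with end).

Lemma cell_map0 : cell_map (cells_at 0) (cells_at 1).
Proof. by exists (fun k (v : void) => match v with end) => k []. Qed.

Fixpoint cell_map_at i : cell_map (cells_at i) (cells_at i.+1) :=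
  if i is j.+1 then cell_map_next (cell_map_at j) else cell_map0.

Definition am_complex : D0_complex S := @D0Complex R S (fun i => lv_complex (cells_at i))
  (fun i => @lv_proj i (cells_at i)) (fun i => lv_lambda (cell_map_at i))
  (fun i => lv_alpha (cells_at i)) (fun i => lv_comm (cell_map_at i)).

Definition am_map : D0_map am_complex C := @D0Map R S am_complex C
  (fun i => lv_map (cells_at i)) (fun i => lv_map_lambda (cell_map_at i))
  (fun i => @lv_map_alpha i (cells_at i)).

Definition am_incl : D0_map Y am_complex := @D0Map R S Y am_complex
  (fun i => lv_inl (cells_at i)) (fun i k x => esym (lv_lambda_inl (cell_map_at i) x))
  (fun i k x => esym (@lv_alpha_inl i (cells_at i) k x)).

(** Each pair to be lifted is a generator. *)
Lemma am_ample : ample am_map.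
Proof.
move=> i k y c yc.
pose v : cs_sort (lv_next (cells_at i)) k := exist _ (y, c) yc.
exists (lv_inr (lv_next (cells_at i)) k (disc_gen R v)).
by split; [exact: lv_alpha_gen | exact: lv_map_gen].
Qed.

Local Transparent lv_complex lv_inl lv_inr.

Lemma lv_fst_lambda i (s : cell_set i) (s' : cell_set i.+1) (L : cell_map s s') k x :
  chain_fst (Y i.+1) (disc R (cs_sort s')) k (lv_lambda L k x) =
  d0_lambda Y i k (chain_fst (Y i) (disc R (cs_sort s)) k x).
Proof.
move: k x; apply: (eq_lv
  (F := chain_comp (chain_fst (Y i.+1) (disc R (cs_sort s'))) (lv_lambda L))
  (G := chain_comp (d0_lambda Y i) (chain_fst (Y i) (disc R (cs_sort s))))) => k v.
  by rewrite [LHS](congr1 fst (lv_lambda_inl L v)).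
by rewrite [LHS](congr1 fst (lv_lambda_gen L v)) [RHS]linear0.
Qed.

(** The chain maps [r i] commute with lambda only; together with [j] they show
that the enlargement has the same homology. *)
Theorem ample_replacement : exists (X : D0_complex S) (f' : D0_map X C)
    (j : D0_map Y X) (r : forall i, chain_map (X i) (Y i)),
  [/\ ample f', forall i k y, f' i k (j i k y) = f i k y,
      forall i k x, r i.+1 k (d0_lambda X i k x) = d0_lambda Y i k (r i k x)
    & forall i k (x : X i (k + 1)), diff (X i) k x = 0 ->
        exists z, diff (X i) (k + 1) z = x - j i (k + 1) (r i (k + 1) x)].
Proof.
exists am_complex, am_map, am_incl, (fun i => chain_fst _ _); split.
- exact: am_ample.
- by move=> i k y; exact: lv_map_inl.
- by move=> i k x; exact: lv_fst_lambda.
- move=> i k [y v] [dy dv].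
  have [v' v'E] := @disc_exact R _ k v (congr1 (pair 0) dv).
  exists (0, v'); transitivity ((0, v) : lv_complex (cells_at i) (k + 1)).
    by congr (_, _); [exact: linear0 | exact: v'E].
  by congr (_, _); rewrite /= ?subrr ?subr0.
Qed.

End Ample.

(** * Attaching cells at one index *)

Section IntShift.

Lemma int_pred (k : int) : exists l, k = l + 1.
Proof. by exists (k - 1); rewrite subrK. Qed.

(** Data indexed by the degrees [k + 1] are data indexed by all degrees. *)
Lemma int_family (P : int -> Type) (phi : forall k, P (k + 1)) :
  exists psi : forall k, P k, forall k, psi (k + 1) = phi k.
Proof.
exists (fun k => eq_rect (k - 1 + 1) P (phi (k - 1)) k (subrK 1 k)) => k.
move: (k + 1 - 1) (subrK 1 (k + 1)) => l E.
have lk : l = k by apply: (addIr 1).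
by subst l; rewrite (eq_irrelevance E erefl).
Qed.

End IntShift.

Section Attach.
Variables (R : pzRingType) (S : bimodule R) (Y C : D0_complex S) (f : D0_map Y C).

Definition in_ker (X : D0_complex S) i (k : int) : X i k -> Prop :=
  if i is j.+1 return X i k -> Prop then fun x => d0_alpha X j k x = 0
  else fun _ => True.

(** Cells to attach at index [i]: a cell [g] in degree [k] gets the boundary
[cl_bd g - d g], is sent by lambda to [cl_lam g] and by the extended map to
[cl_val g], and has alpha g = 0. The equations are what is needed for the
result to be a D_0-complex with a map to [C]. *)
Record cells i := Cells {
  cl :> complex R;
  cl_proj : projective_complex cl;
  cl_bd : forall k, {linear cl (k + 1) -> Y i k};
  cl_lam : forall k, {linear cl k -> Y i.+1 k};
  cl_val : forall k, {linear cl k -> C i k};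
  cl_bd_diff : forall k x, diff (Y i) k (cl_bd (k + 1) x) = cl_bd k (diff cl (k + 1) x);
  cl_lam_diff : forall k x, diff (Y i.+1) k (cl_lam (k + 1) x) =
    d0_lambda Y i k (cl_bd k x) - cl_lam k (diff cl k x);
  cl_val_diff : forall k x, diff (C i) k (cl_val (k + 1) x) =
    f i k (cl_bd k x) - cl_val k (diff cl k x);
  cl_val_lam : forall k x, d0_lambda C i k (cl_val k x) = f i.+1 k (cl_lam k x);
  cl_bd_ker : forall k x, in_ker (cl_bd k x);
  cl_lam_ker : forall k x, d0_alpha Y i k (cl_lam k x) = 0;
  cl_val_ker : forall k x, in_ker (cl_val k x) }.

Variable G : forall i, cells i.

Definition at_diff i (k : int) : {linear (Y i (k + 1)%R * G i (k + 1)%R)%type ->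
    (Y i k * G i k)%type} :=
  pairl (copairl (diff (Y i) k) (cl_bd (G i) k)) (\- (diff (G i) k \o snd)).

Lemma at_diffK i k x : at_diff i k (at_diff i (k + 1) x) = 0.
Proof.
congr (_, _); last by rewrite /= linearN diffK !oppr0.
by rewrite /= linearD diffK add0r cl_bd_diff linearN subrr.
Qed.

Definition at_complex i : complex R :=
  @Complex R (fun k => (Y i k * G i k)%type) (at_diff i) (@at_diffK i).

Lemma at_proj i : projective_complex (at_complex i).
Proof. by move=> k; apply: projective_pair; [exact: d0_proj | exact: cl_proj]. Qed.

Lemma at_inl_comm i k x :
  inl_lin (Y i k) (G i k) (diff (Y i) k x) =
  diff (at_complex i) k (inl_lin (Y i (k + 1)) (G i (k + 1)) x).
Proof. by rewrite /= !linear0 addr0. Qed.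

Definition at_inl i : chain_map (Y i) (at_complex i) :=
  @ChainMap R (Y i) (at_complex i) (fun k => inl_lin (Y i k) (G i k)) (@at_inl_comm i).

Section Out.
Variables (i : nat) (M : complex R) (a : chain_map (Y i) M)
  (b : forall k, {linear G i k -> M k}).
Hypothesis ab : forall k x, diff M k (b (k + 1) x) =
  a k (cl_bd (G i) k x) - b k (diff (G i) k x).

Lemma at_out_comm k x :
  copairl (a k) (b k) (diff (at_complex i) k x) =
  diff M k (copairl (a (k + 1)) (b (k + 1)) x).
Proof. by rewrite /= !linearD linearN ab !chain_comm addrA. Qed.

Definition at_out : chain_map (at_complex i) M :=
  @ChainMap R (at_complex i) M (fun k => copairl (a k) (b k)) at_out_comm.

End Out.

Lemma at_lambda_subproof i k x :
  diff (at_complex i.+1) k ((at_inl i.+1 (k + 1) \o cl_lam (G i) (k + 1)) x) =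
  chain_comp (at_inl i.+1) (d0_lambda Y i) k (cl_bd (G i) k x) -
  (at_inl i.+1 k \o cl_lam (G i) k) (diff (G i) k x).
Proof.
transitivity (at_inl i.+1 k (diff (Y i.+1) k (cl_lam (G i) (k + 1) x))).
  by rewrite chain_comm.
by rewrite cl_lam_diff linearB.
Qed.

Definition at_lambda i : chain_map (at_complex i) (at_complex i.+1) :=
  at_out (@at_lambda_subproof i).

Lemma at_alpha_subproof i k x :
  diff (tens_complex S (at_complex i)) k ((\0 : {linear G i.+1 (k + 1) -> _}) x) =
  chain_comp (tens_chain S (at_inl i)) (d0_alpha Y i) k (cl_bd (G i.+1) k x) -
  (\0 : {linear G i.+1 k -> tens_complex S (at_complex i) k}) (diff (G i.+1) k x).
Proof.
rewrite linear0 subr0 [RHS]/= (_ : d0_alpha Y i k _ = 0) ?linear0 //.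
exact: (cl_bd_ker (c := G i.+1)).
Qed.

Definition at_alpha i : chain_map (at_complex i.+1) (tens_complex S (at_complex i)) :=
  at_out (@at_alpha_subproof i).

Lemma at_comm i k x : at_alpha i.+1 k (at_lambda i.+1 k x) =
  tens_chain S (at_lambda i) k (at_alpha i k x).
Proof.
case: x => y g; rewrite /= !addr0 linearD cl_lam_ker addr0 d0_comm /=.
rewrite !tens_map_comp; apply: eq_tens_map => z.
by rewrite /= !(linear0, addr0).
Qed.

Definition attach : D0_complex S := @D0Complex R S at_complex at_proj at_lambda
  at_alpha at_comm.

Lemma at_map_lambda i k x :
  at_out (cl_val_diff (c := G i.+1)) k (at_lambda i k x) =
  d0_lambda C i k (at_out (cl_val_diff (c := G i)) k x).
Proof.
case: x => y g; rewrite /= !(linear0, addr0) !linearD d0_fun_lambda.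
by rewrite cl_val_lam.
Qed.

Lemma at_map_alpha i k x :
  tens_chain S (at_out (cl_val_diff (c := G i))) k (at_alpha i k x) =
  d0_alpha C i k (at_out (cl_val_diff (c := G i.+1)) k x).
Proof.
case: x => y g; have g0 : d0_alpha C i k (cl_val (G i.+1) k g) = 0.
  exact: (cl_val_ker (c := G i.+1)).
rewrite [RHS]linearD [X in _ = _ + X]g0 addr0 -d0_fun_alpha /= addr0.
rewrite tens_map_comp; apply: eq_tens_map => z.
by rewrite /= !(linear0, addr0).
Qed.

Definition at_map : D0_map attach C := @D0Map R S attach C
  (fun i => at_out (cl_val_diff (c := G i))) at_map_lambda at_map_alpha.

Lemma at_incl_lambda i k x : at_inl i.+1 k (d0_lambda Y i k x) =
  at_lambda i k (at_inl i k x).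
Proof. by rewrite /= !(linear0, addr0). Qed.

Lemma at_incl_alpha i k x : tens_chain S (at_inl i) k (d0_alpha Y i k x) =
  at_alpha i k (at_inl i.+1 k x).
Proof. by rewrite /= !(linear0, addr0). Qed.

Definition at_incl : D0_map Y attach := @D0Map R S Y attach at_inl
  at_incl_lambda at_incl_alpha.

End Attach.

Section CellsExist.
Variables (R : pzRingType) (S : bimodule R) (Y C : D0_complex S) (f : D0_map Y C).

Definition zero_cplx : complex R :=
  @Complex R (fun _ => zero_mod R) (fun _ => \0) (fun _ _ => erefl).

Lemma in_ker0 (X : D0_complex S) i k : in_ker (0 : X i k).
Proof. by case: i => [|i] //=; rewrite linear0. Qed.

Lemma no_cells i : exists G : cells f i, forall k (x : G k), x = 0.
Proof.
have zproj : projective_complex zero_cplx.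
  by move=> k; apply: projective_trivial; exact: zero_mod_eq0.
unshelve eexists (@Cells _ _ _ _ f i zero_cplx zproj (fun=> \0) (fun=> \0)
  (fun=> \0) _ _ _ _ _ _ _); move=> k x /=;
  rewrite ?linear0 ?addr0 //; first [exact: in_ker0 | exact: zero_mod_eq0].
Qed.

Variables (p : nat) (c : int).

Definition res_diff (k : int) :
   {linear (Y p.+1 (k + 1)%R * Y p.+2 (k + 1 + 1)%R * C p.+1 (k + 1 + 1)%R)%type ->
    (Y p.+1 k * Y p.+2 (k + 1)%R * C p.+1 (k + 1)%R)%type} :=
  pairl (pairl (diff (Y p.+1) k \o (fst \o fst))
    ((d0_lambda Y p.+1 (k + 1) \o (fst \o fst)) \- (diff (Y p.+2) (k + 1) \o (snd \o fst))))
    ((f p.+1 (k + 1) \o (fst \o fst)) \- (diff (C p.+1) (k + 1) \o snd)).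

Lemma res_diffK k x : res_diff k (res_diff (k + 1) x) = 0.
Proof.
case: x => -[x w] t; rewrite /= !linearB !diffK !chain_comm.
by rewrite /= !oppr0 !addr0 !subrr.
Qed.

(** Triples (x, w, th) where [x] is a boundary to be prescribed at index
[p.+1], [w] a nullhomotopy of its image at index [p.+2], and [th] a
nullhomotopy of its image in [C]. With the conditions [obstruction] below it
represents, when [f] is ample and the fibre of [C] is acyclic, the homotopy
fibre of lambda : Ker alpha_(p+1) -> Ker alpha_(p+2) in [Y]. *)
Definition obstruction_complex : complex R :=
  @Complex R (fun k => (Y p.+1 k * Y p.+2 (k + 1)%R * C p.+1 (k + 1)%R)%type)
    res_diff res_diffK.

Definition obstruction k (x : obstruction_complex k) :=
  [/\ d0_alpha Y p k x.1.1 = 0, d0_alpha Y p.+1 (k + 1) x.1.2 = 0,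
      d0_alpha C p (k + 1) x.2 = 0
    & d0_lambda C p.+1 (k + 1) x.2 = f p.+2 (k + 1) x.1.2].

Lemma resolving_cells : exists (G : cells f p.+1),
  (forall k (x : G k), k <= c + 1 -> x = 0) /\
  (forall k (g : G (k + 1)) (x : obstruction_complex (k + 1)), c <= k ->
     diff G k g = 0 -> diff obstruction_complex k x =
       (cl_bd G k g, cl_lam G (k + 1) g, cl_val G (k + 1) g) ->
     obstruction x ->
   exists g', diff G (k + 1) g' = g /\ cl_bd G (k + 1) g' = x.1.1).
Proof.
have [G [tau [Gproj G0 tauD tauQ Glift]]] := resolution obstruction c.
have [w wE] := int_family (P := fun k => {linear G k -> Y p.+2 k})
  (fun k => (snd \o fst) \o tau k).
have [v vE] := int_family (P := fun k => {linear G k -> C p.+1 k})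
  (fun k => snd \o tau k).
unshelve eexists (@Cells _ _ _ _ f p.+1 G Gproj (fun k => (fst \o fst) \o tau k) w v
  _ _ _ _ _ _ _).
- by move=> k x; have /(congr1 (fst \o fst)) := tauD k x.
- move=> k x; have [l lE] := int_pred k; subst k; rewrite !wE.
  by have /(congr1 (snd \o fst)) /= <- := tauD l x; rewrite subKr.
- move=> k x; have [l lE] := int_pred k; subst k; rewrite !vE.
  by have /(congr1 snd) /= <- := tauD l x; rewrite subKr.
- move=> k x; have [l lE] := int_pred k; subst k; rewrite wE vE.
  apply/eqP; rewrite -subr_eq0; apply/eqP.
  apply: (tauQ l _ ((d0_lambda C p.+1 (l + 1) \o snd) \-
    (f p.+2 (l + 1) \o (snd \o fst)))) => y [_ _ _ /= ->]; exact: subrr.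
- by move=> k x; apply: (tauQ k _ (d0_alpha Y p k \o (fst \o fst))) => y [].
- move=> k x; have [l lE] := int_pred k; subst k; rewrite wE.
  by apply: (tauQ l _ (d0_alpha Y p.+1 (l + 1) \o (snd \o fst))) => y [].
- move=> k x; have [l lE] := int_pred k; subst k; rewrite vE.
  by apply: (tauQ l _ (d0_alpha C p (l + 1) \o snd)) => y [].
split=> [//|k g x ck dg xg Qx].
have [|g' [dg' g'x]] := Glift k g x ck dg _ Qx.
  by rewrite xg /= wE vE /=; case: (tau k g) => -[].
by exists g'; rewrite -g'x.
Qed.

End CellsExist.

(** * Homology and flatness *)

Section FlatComplexes.
Variables (R : pzRingType) (S : bimodule R).
Hypothesis S_flat : flat_on_left S.

Lemma tens_map_add (M N : rmodType R) (f g : {linear M -> N}) u :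
  tens_map S (f \+ g) u = tens_map S f u + tens_map S g u.
Proof.
pose h : {linear tensor S M -> tensor S N} := tens_map S f \+ tens_map S g.
rewrite -[RHS]/(h u); move: u; apply: tens_ext => x y.
by rewrite /= !tens_map_tens tensDl.
Qed.

Lemma tens_map_eq0 (M N : rmodType R) (f : {linear M -> N}) u :
  (forall x, f x = 0) -> tens_map S f u = 0.
Proof.
move=> f0; rewrite -[RHS]/((\0 : {linear tensor S M -> tensor S N}) u).
move: u; apply: tens_ext => x y; rewrite /= tens_map_tens f0.
by apply: (addIr (tens 0 y)); rewrite -tensDl !add0r.
Qed.

Lemma flat_exact_at (X : complex R) k :
  exact_at X k -> exact_at (tens_complex S X) k.
Proof. by move=> X_exact; apply: flat_exact. Qed.

Definition homology_injective (A B : complex R) (F : chain_map A B) (k : int) :=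
  forall (a : A (k + 1)) b, diff A k a = 0 -> F (k + 1) a = diff B (k + 1) b ->
  exists z, diff A (k + 1) z = a.

(** Injectivity on homology in degree [k + 1], with vanishing homology of [B]
one degree higher, is exactness of the mapping cone of [F]; exactness is
preserved by a flat tensor product. *)
Lemma flat_homology_injective (A B : complex R) (F : chain_map A B) k :
  exact_at B (k + 1) -> homology_injective F k ->
  homology_injective (tens_chain S F) k.
Proof.
move=> B_exact F_inj u w du Fu.
(* [out] and [into] are consecutive differentials of the mapping cone. *)
pose out : {linear (A (k + 1 + 1)%R * B (k + 1 + 1 + 1)%R)%type ->
    (A (k + 1)%R * B (k + 1 + 1)%R)%type} :=
  pairl (diff A (k + 1) \o fst)
    ((F (k + 1 + 1) \o fst) \- (diff B (k + 1 + 1) \o snd)).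
pose into : {linear (A (k + 1)%R * B (k + 1 + 1)%R)%type ->
    (A k * B (k + 1)%R)%type} :=
  pairl (diff A k \o fst) ((F (k + 1) \o fst) \- (diff B (k + 1) \o snd)).
pose uw : tensor S (A (k + 1)%R * B (k + 1 + 1)%R)%type :=
  tens_map S (inl_lin _ _) u + tens_map S (inr_lin _ _) w.
have exact b : into b = 0 -> exists a, out a = b.
  case: b => a b /= [da Fab].
  have [z zE] := F_inj a b da (subr0_eq Fab).
  have [|t tE] := B_exact (F (k + 1 + 1) z - b).
    by rewrite linearB -chain_comm zE.
  by exists (z, t); rewrite /= zE tE subKr.
have [|v vE] := flat_exact S_flat exact (u := uw).
  have into_inl : into \o inl_lin _ _ =1
      (inl_lin _ _ \o diff A k) \+ (inr_lin _ _ \o F (k + 1)).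
    by move=> x; congr (_, _); rewrite /= ?linear0 ?subr0 ?addr0 ?add0r.
  have into_inr : into \o inr_lin _ _ =1 inr_lin _ _ \o (\- diff B (k + 1)).
    by move=> x; congr (_, _); rewrite /= ?linear0 ?add0r.
  rewrite linearD /= !tens_map_comp (eq_tens_map into_inl) (eq_tens_map into_inr).
  rewrite tens_map_add -!tens_map_comp.
  rewrite -[tens_map S (diff A k) u]/(diff (tens_complex S A) k u) du linear0 add0r.
  rewrite -[tens_map S (F (k + 1)) u]/(tens_chain S F (k + 1) u) Fu -linearD /=.
  rewrite -tens_map_add [X in tens_map _ _ X]tens_map_eq0 ?linear0 // => x.
  exact: subrr.
exists (tens_map S fst v).
transitivity (tens_map S fst uw).
  by rewrite -vE /= !tens_map_comp; apply: eq_tens_map.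
rewrite linearD /= !tens_map_comp (tens_map_id (f := fst \o _)) //.
by rewrite tens_map_eq0 ?addr0.
Qed.

End FlatComplexes.

(** * Killing homology over the target *)

Section Killing.
Variables (R : pzRingType) (S : bimodule R).
Hypothesis S_flat : flat_on_left S.

(** The homotopy fibre of lambda : Ker alpha_(p+1) -> Ker alpha_(p+2) is
acyclic: its cycles are the pairs (x, w), its chains the pairs (z, t). *)
Definition fiber_exact (C : D0_complex S) p :=
  forall (k : int) (x : C p.+1 (k + 1)) (w : C p.+2 (k + 1 + 1)),
    d0_alpha C p (k + 1) x = 0 -> d0_alpha C p.+1 (k + 1 + 1) w = 0 ->
    diff (C p.+1) k x = 0 ->
    diff (C p.+2) (k + 1) w = d0_lambda C p.+1 (k + 1) x ->
  exists z t, [/\ d0_alpha C p (k + 1 + 1) z = 0,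
    d0_alpha C p.+1 (k + 1 + 1 + 1) t = 0, diff (C p.+1) (k + 1) z = x
    & w = d0_lambda C p.+1 (k + 1 + 1) z + diff (C p.+2) (k + 1 + 1) t].

Variable C : D0_complex S.
Hypothesis C_reduced : D0_reduced C.

Section AmpleLift.
Variables (X : D0_complex S) (f : D0_map X C).
Hypothesis f_ample : ample f.

Lemma ample_reduced : D0_reduced X.
Proof.
move=> i k y; have [c cE] := C_reduced (tens_map S (f i k) y).
by have [x [xE _]] := f_ample cE; exists x.
Qed.

Lemma ample_lift i k (c : C i.+1 k) : d0_alpha C i k c = 0 ->
  exists x, d0_alpha X i k x = 0 /\ f i.+1 k x = c.
Proof. by move=> c0; apply: f_ample; rewrite linear0. Qed.

Variables (p : nat) (k : int).
Hypothesis C_fiber : fiber_exact C p.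
Hypothesis X_exact : exact_at (X p.+1) (k + 1).

(** A cycle (tau, w, th) of the obstruction complex whose first component
bounds [x], up to homology in the other places, is the boundary of a triple
whose first component is [x] modulo boundaries. Ampleness is used three times
to correct [x] and its nullhomotopy so that alpha vanishes on them, and once to
absorb the ambiguity left by the acyclicity of the fibre of [C]. *)
Lemma obstruction_lift (x : X p.+1 (k + 1)) (tau : X p.+1 k) (w : X p.+2 (k + 1))
    (th : C p.+1 (k + 1)) u w' :
    obstruction (f := f) (tau, w, th) ->
    diff (X p.+1) k x = tau ->
    diff (X p.+2) k w = d0_lambda X p.+1 k tau ->
    diff (C p.+1) k th = f p.+1 k tau ->
    d0_alpha X p (k + 1) x = diff (tens_complex S (X p)) (k + 1) u ->
    d0_lambda X p.+1 (k + 1) x - w = diff (X p.+2) (k + 1) w' ->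
  exists (v : X p.+1 (k + 1 + 1)) (xi : obstruction_complex f p (k + 1)),
    [/\ obstruction xi, diff (obstruction_complex f p) k xi = (tau, w, th)
      & xi.1.1 = x - diff (X p.+1) (k + 1) v].
Proof.
move=> [/= tau0 w0 th0 thw] dx dw dth ax lx.
have [v vE] := ample_reduced u.
pose x1 := x - diff (X p.+1) (k + 1) v.
have dx1 : diff (X p.+1) k x1 = tau by rewrite linearB diffK subr0.
have ax1 : d0_alpha X p (k + 1) x1 = 0 by rewrite linearB chain_comm ax vE subrr.
pose w1 := w' - d0_lambda X p.+1 (k + 1 + 1) v.
have dw1 : diff (X p.+2) (k + 1) w1 = d0_lambda X p.+1 (k + 1) x1 - w.
  by rewrite !linearB -lx -chain_comm addrAC.
have [|s sE] := flat_exact_at S_flat X_exact (x := d0_alpha X p.+1 (k + 1 + 1) w1).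
  by rewrite -chain_comm dw1 linearB w0 d0_comm ax1 linear0 subrr.
have [t tE] := ample_reduced s.
pose w2 := w1 - diff (X p.+2) (k + 1 + 1) t.
have dw2 : diff (X p.+2) (k + 1) w2 = d0_lambda X p.+1 (k + 1) x1 - w.
  by rewrite linearB diffK subr0.
have aw2 : d0_alpha X p.+1 (k + 1 + 1) w2 = 0.
  by rewrite linearB chain_comm tE sE subrr.
have [||||z [t1 [z0 t10 dz fw2]]] := C_fiber (x := f p.+1 (k + 1) x1 - th)
    (w := f p.+2 (k + 1 + 1) w2).
- by rewrite linearB th0 subr0 -d0_fun_alpha ax1 linear0.
- by rewrite -d0_fun_alpha aw2 linear0.
- by rewrite linearB -chain_comm dx1 dth subrr.
- by rewrite -chain_comm dw2 !linearB !d0_fun_lambda thw.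
have [t2 [t20 ft2]] := ample_lift t10.
exists v, (x1, w2 - diff (X p.+2) (k + 1 + 1) t2, z); split=> //=.
- split=> //=; first by rewrite linearB aw2 chain_comm t20 linear0 subrr.
  by rewrite [RHS]linearB fw2 chain_comm ft2 addrK.
- by rewrite dx1 linearB diffK subr0 dw2 dz !subKr.
Qed.

End AmpleLift.

Definition d0_comp (X Y Z : D0_complex S) (g : D0_map Y Z) (f : D0_map X Y) :
  D0_map X Z.
Proof.
apply: (@D0Map R S X Z (fun i => chain_comp (g i) (f i))) => i k x.
  by rewrite /= !d0_fun_lambda.
rewrite /= -d0_fun_alpha -d0_fun_alpha /= tens_map_comp.
exact: eq_tens_map.
Defined.

(** [g] extends [f] to a larger D_0-complex, and the enlargement creates no
homology in degrees up to [c + 1]. *)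
Definition enlarges (c : int) (X Y : D0_complex S) (f : D0_map X C) (g : D0_map Y C) :=
  exists j : D0_map X Y, (forall i k x, g i k (j i k x) = f i k x) /\
    forall i k (y : Y i (k + 1)), k <= c -> diff (Y i) k y = 0 ->
    exists x z, diff (X i) k x = 0 /\ diff (Y i) (k + 1) z = y - j i (k + 1) x.

Lemma enlarges_refl c X (f : D0_map X C) : enlarges c f f.
Proof.
exists (@D0Map R S X X (fun i => chain_id (X i)) (fun _ _ _ => erefl)
  (fun i k x => tens_map_id (f := idfun) (fun _ => erefl) _)); split=> // i k y _ dy.
by exists y, 0; rewrite linear0 subrr.
Qed.

Lemma enlarges_trans c X Y Z (f : D0_map X C) (g : D0_map Y C) (h : D0_map Z C) :
  enlarges c f g -> enlarges c g h -> enlarges c f h.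
Proof.
move=> [j [jf jE]] [l [lg lE]]; exists (d0_comp l j); split=> [i k x|i k y kc dy].
  by rewrite /= lg jf.
have [x [z [dx zE]]] := lE i k y kc dy.
have [x' [z' [dx' zE']]] := jE i k x kc dx.
exists x', (z + l i (k + 1 + 1) z'); split=> //.
by rewrite linearD zE -chain_comm zE' linearB /= addrA subrK.
Qed.

Lemma enlarges_exact c X Y (f : D0_map X C) (g : D0_map Y C) i k :
  enlarges c f g -> k <= c -> exact_at (X i) k -> exact_at (Y i) k.
Proof.
move=> [j [_ jE]] kc X_exact y dy; have [x [z [dx zE]]] := jE i k y kc dy.
have [z' z'E] := X_exact x dx; exists (z + j i (k + 1 + 1) z').
by rewrite linearD zE -chain_comm z'E subrK.
Qed.

(** The homology vanishes in degrees above [c]. *)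
Definition bounded (c : int) (X : D0_complex S) :=
  forall i k, c <= k -> exact_at (X i) k.

(** The last clause of [resolution] for the obstruction complex, as a property
of cells. *)
Definition resolves (X : D0_complex S) (f : D0_map X C) (c : int) i : cells f i -> Prop :=
  if i is p.+1 return cells f i -> Prop then fun G =>
    forall k (g : G (k + 1)) (x : obstruction_complex f p (k + 1)), c <= k ->
     diff G k g = 0 -> diff (obstruction_complex f p) k x =
       (cl_bd G k g, cl_lam G (k + 1) g, cl_val G (k + 1) g) ->
     obstruction x ->
   exists g', diff G (k + 1) g' = g /\ cl_bd G (k + 1) g' = x.1.1
  else fun _ => True.

Section AttachResolving.
Variables (X : D0_complex S) (f : D0_map X C) (p : nat) (c : int).
Variable G : forall i, cells f i.
Hypothesis f_ample : ample f.
Hypothesis C_fiber : fiber_exact C p.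
Hypothesis X_bounded : bounded (c + 1) X.
Hypothesis X_inj : homology_injective (d0_lambda X p) c.
Hypothesis G_low : forall i k (g : G i k), k <= c + 1 -> g = 0.
Hypothesis G_off : forall i, i <> p.+1 -> forall k (g : G i k), g = 0.
Hypothesis G_resolves : resolves c (G p.+1).

Let Xt i k : c + 1 <= k -> exact_at (tens_complex S (X i)) k.
Proof. by move=> ck; apply/flat_exact_at/X_bounded. Qed.

(** The attached resolution has no homology above its lowest degree, so no
homology appears above the killed degree. *)
Lemma attach_bounded : bounded (c + 1) (attach G).
Proof.
move=> i k ck [y g] [dy dg]; have [ip|/eqP ip] := eqVneq i p.+1; last first.
  rewrite (G_off ip g) linear0 addr0 in dy *.
  by have [z zE] := X_bounded ck dy; exists (z, 0); rewrite /= !linear0 addr0 zE.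
subst i; move/eqP: dg; rewrite oppr_eq0 => /eqP dg.
have dNy : diff (X p.+1) k (- y) = cl_bd (G p.+1) k g.
  by rewrite linearN; apply/eqP; rewrite eq_sym -addr_eq0 addrC dy.
have bd0 : d0_alpha X p k (cl_bd (G p.+1) k g) = 0 by exact: (cl_bd_ker (c := G p.+1)).
have [|u uE] := Xt ck (i := p) (x := d0_alpha X p (k + 1) (- y)).
  by rewrite -chain_comm dNy bd0.
have [|w wE] := X_bounded (i := p.+2) ck
    (x := d0_lambda X p.+1 (k + 1) (- y) - cl_lam (G p.+1) (k + 1) g).
  by rewrite linearB -chain_comm dNy cl_lam_diff dg linear0 subr0 subrr.
have ck1 : c + 1 <= k + 1 by lia.
have [|||v [xi [xi_obs dxi xiE]]] := @obstruction_lift X f f_ample p k C_fiber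
  (X_bounded ck1) (- y) (cl_bd (G p.+1) k g) (cl_lam (G p.+1) (k + 1) g)
  (cl_val (G p.+1) (k + 1) g) u w _ dNy _ _ (esym uE) (esym wE).
- split=> /=; [exact: bd0 | exact: cl_lam_ker | | exact: cl_val_lam].
  exact: (cl_val_ker (c := G p.+1)).
- by rewrite cl_lam_diff dg linear0 subr0.
- by rewrite cl_val_diff dg linear0 subr0.
have ck0 : c <= k by lia.
have [g' [dg' bdg']] := G_resolves ck0 dg dxi xi_obs.
exists (- v, - g'); congr (_, _) => /=.
  rewrite !linearN bdg' xiE opprD !opprK.
  by rewrite [y + _]addrC addrA addNr add0r.
by rewrite linearN opprK.
Qed.

(** Injectivity of the tensored lambda at index [p] makes alpha vanish in
homology on a class in the kernel of lambda at index [p.+1]; such a class lies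
in the obstruction complex and is killed by a cell. *)
Lemma attach_injective : homology_injective (d0_lambda (attach G) p.+1) c.
Proof.
move=> [y g] [w g2] [dy _] [lyw _].
have g0 : g = 0 by exact: G_low.
have g20 : g2 = 0 by apply: G_off; lia.
subst g g2; rewrite /= !linear0 !addr0 in dy lyw *.
have [||u uE] := flat_homology_injective S_flat (X_bounded (lexx _)) X_inj
    (a := d0_alpha X p (c + 1) y) (b := d0_alpha X p.+1 (c + 1 + 1) w).
- by rewrite -chain_comm dy linear0.
- by rewrite -d0_comm lyw chain_comm.
have ck1 : c + 1 <= c + 1 := lexx _.
have [||||v [xi [xi_obs dxi xiE]]] := @obstruction_lift X f f_ample p c C_fiber
  (X_bounded ck1) y 0 0 0 u w _ dy _ _ (esym uE) _.
- by split; rewrite /= !linear0.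
- by rewrite !linear0.
- by rewrite !linear0.
- by rewrite subr0.
have [|g' [dg' bdg']] := G_resolves (lexx c) (linear0 _ : diff _ c 0 = 0) _ xi_obs.
  by rewrite dxi !linear0.
exists (v, g'); congr (_, _) => /=.
  by rewrite bdg' xiE [LHS]addrCA subrr addr0.
by rewrite dg' oppr0.
Qed.

Lemma attach_enlarges : enlarges c f (at_map G).
Proof.
exists (at_incl G); split=> [i k x|i k [y g] kc [dy _]].
  by rewrite /= linear0 addr0.
have g0 : g = 0 by apply: G_low; lia.
subst g; rewrite linear0 addr0 in dy.
by exists y, 0; split=> //; rewrite linear0 subrr.
Qed.

End AttachResolving.

(** Replace [f] by an ample map, then attach at index [p.+1] a resolution of
the obstruction complex. *)
Lemma kill_kernel X (f : D0_map X C) p c :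
    fiber_exact C p -> bounded (c + 1) X -> homology_injective (d0_lambda X p) c ->
  exists Y (g : D0_map Y C), [/\ enlarges c f g, bounded (c + 1) Y
    & homology_injective (d0_lambda Y p.+1) c].
Proof.
move=> C_fib Xb Xinj.
have [Y [g [j [r [g_ample gj rl rE]]]]] := ample_replacement f.
have fg : enlarges c f g.
  exists j; split=> // i k y kc dy; have [z zE] := rE i k y dy.
  by exists (r i (k + 1) y), z; rewrite -chain_comm dy linear0.
have Yb : bounded (c + 1) Y.
  move=> i k ck y dy; have [z zE] := rE i k y dy.
  have [|t tE] := Xb i k ck (r i (k + 1) y); first by rewrite -chain_comm dy linear0.
  by exists (z + j i (k + 1 + 1) t); rewrite linearD zE -chain_comm tE subrK.
have Yinj : homology_injective (d0_lambda Y p) c.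
  move=> a b da ab; have [z zE] := rE p c a da.
  have [||t tE] := Xinj (r p (c + 1) a) (r p.+1 (c + 1 + 1) b).
  - by rewrite -chain_comm da linear0.
  - by rewrite -rl ab chain_comm.
  by exists (z + j p (c + 1 + 1) t); rewrite linearD zE -chain_comm tE subrK.
have G_ex i : exists G : cells g i, [/\ forall k (x : G k), k <= c + 1 -> x = 0,
    i <> p.+1 -> forall k (x : G k), x = 0 & i = p.+1 -> resolves c G].
  have [->|/eqP ip] := eqVneq i p.+1.
    by have [G [G_low G_res]] := resolving_cells g p c; exists G.
  by have [G G0] := no_cells g i; exists G; split=> // k x _; exact: G0.
pose G i := sval (cid (G_ex i)).
have GP i := svalP (cid (G_ex i)).
have G_low i k (x : G i k) : k <= c + 1 -> x = 0 by case: (GP i) => + _ _; apply.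
have G_off i : i <> p.+1 -> forall k (x : G i k), x = 0 by case: (GP i).
have G_res : resolves c (G p.+1) by case: (GP p.+1) => _ _; apply.
exists (attach G), (at_map G); split.
- by apply: enlarges_trans fg _; exact: attach_enlarges.
- exact: attach_bounded G_res.
- exact: attach_injective G_res.
Qed.

Variable n : nat.
Hypothesis C_fiber : forall p, (p.+1 < n)%N -> fiber_exact C p.

Lemma inject_upto X (f : D0_map X C) c m r :
    (m <= r < n)%N -> bounded (c + 1) X -> exact_at (X 0%N) c ->
  exists Y (g : D0_map Y C), [/\ enlarges c f g, bounded (c + 1) Y
    & homology_injective (d0_lambda Y m) c].
Proof.
case/andP=> + rn Xb X0; elim: m => [_|m IH mr].
  exists X, f; split=> //; first exact: enlarges_refl.
  by move=> a b da _; exact: X0.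
have [Y [g [fg Yb Yinj]]] := IH (ltnW mr).
have [Z [h [gh Zb Zinj]]] := kill_kernel g (C_fiber (leq_ltn_trans mr rn)) Yb Yinj.
by exists Z, h; split=> //; exact: enlarges_trans fg gh.
Qed.

(** If the top homology vanishes at all indices above [r], then injectivity of
lambda at [r] makes it vanish at [r] as well. *)
Lemma kill_degree X (f : D0_map X C) c :
    bounded (c + 1) X -> exact_at (X 0%N) c ->
    (forall i, (n <= i)%N -> exact_at (X i) c) ->
  exists Y (g : D0_map Y C), enlarges c f g /\ bounded c Y.
Proof.
move=> Xb X0 Xn.
(* [n - d] bounds the indices where homology in degree [c + 1] remains. *)
suff H d : (d <= n)%N -> exists Y (g : D0_map Y C), [/\ enlarges c f g,
    bounded (c + 1) Y & forall i, (n - d <= i)%N -> exact_at (Y i) c].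
  have [Y [g [fg Yb Yc]]] := H n (leqnn n); exists Y, g; split=> // i k.
  rewrite le_eqVlt => /orP[/eqP<-|ck]; first by apply: Yc; rewrite subnn.
  by apply: Yb; rewrite lezD1.
elim: d => [_|d IH dn].
  by exists X, f; split=> // [|i]; [exact: enlarges_refl | rewrite subn0; exact: Xn].
have [Y [g [fg Yb Yc]]] := IH (ltnW dn).
have rn : (n - d.+1 < n)%N by lia.
have [|Z [h [gh Zb Zinj]]] := @inject_upto Y g c (n - d.+1) (n - d.+1) _ Yb
  (enlarges_exact fg (lexx c) X0); first by rewrite leqnn.
exists Z, h; split=> // [|i]; first exact: enlarges_trans fg gh.
have Zc j : (n - d <= j)%N -> exact_at (Z j) c.
  by move=> dj; apply: (enlarges_exact gh (lexx c)); exact: Yc.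
rewrite leq_eqVlt => /orP[/eqP<-|di]; last by apply: Zc; lia.
have le_r : (n - d <= (n - d.+1).+1)%N by lia.
move=> a da; have [|b bE] := Zc _ le_r (d0_lambda Z _ (c + 1) a).
  by rewrite -chain_comm da linear0.
exact: (Zinj a b da (esym bE)).
Qed.

Lemma kill_all X (f : D0_map X C) a (N : nat) :
    bounded (a + N%:Z) X -> (forall k, exact_at (X 0%N) k) ->
    (forall i k, (n <= i)%N -> exact_at (X i) k) ->
    (forall i k, k < a -> exact_at (X i) k) ->
  exists Y (g : D0_map Y C) (j : D0_map X Y), D0_acyclic Y /\
    forall i k x, f i k x = g i k (j i k x).
Proof.
elim: N X f => [|N IH] X f Xb X0 Xn Xa.
  pose idX := (@D0Map R S X X (fun i => chain_id (X i)) (fun _ _ _ => erefl)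
    (fun i k x => tens_map_id (f := idfun) (fun _ => erefl) _)).
  exists X, f, idX; split=> // i; apply/acyclicP => k.
  by have [ak|/Xa//] := leP a k; apply: Xb; rewrite addr0.
have [|||Y [g [fg Yb]]] := @kill_degree X f (a + N%:Z).
- by move=> i k ak; apply: Xb; lia.
- exact: X0.
- by move=> i; exact: Xn.
have Y_exact i : (forall k, exact_at (X i) k) -> forall k, exact_at (Y i) k.
  move=> Xi k; have [ak|ka] := leP (a + N%:Z) k; first exact: Yb.
  exact: (enlarges_exact fg (ltW ka)).
have [j [jf _]] := fg.
have [|||Z [h [l [Zac lE]]]] := IH Y g Yb.
- exact: Y_exact.
- by move=> i k ni; apply: Y_exact => k'; exact: Xn.
- by move=> i k ka; apply: (enlarges_exact fg _ (Xa i k ka)); lia.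
exists Z, h, (d0_comp l j); split=> // i k x.
by rewrite -jf lE.
Qed.

End Killing.

(** * Objects of A_n have bounded homology *)

Section Finiteness.
Variable R : pzRingType.

Section DirectSum.
Variables (F : int -> rmodType R) (M : rmodType R) (iota : forall k, {linear F k -> M}).
Hypothesis M_sum : is_direct_sum iota.

Lemma direct_sum_proj : exists pi : forall l, {linear M -> F l},
  (forall l x, pi l (iota l x) = x) /\
  (forall k l x, k <> l -> pi l (iota k x) = 0).
Proof.
have pi_ex l : exists pi : {linear M -> F l}, (forall x, pi (iota l x) = x) /\
    (forall k x, k <> l -> pi (iota k x) = 0).
  pose g k : {linear F k -> F l} := match @eqP int k l with
    | ReflectT E => eq_rect k (fun l => {linear F k -> F l}) idfun l E
    | ReflectF _ => \0
    end.
  have [pi [piE _]] := M_sum g; exists pi; split=> [x|k x kl]; rewrite piE /g.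
    by case: eqP => // E; rewrite (eq_irrelevance E erefl).
  by case: eqP.
exists (fun l => sval (cid (pi_ex l))).
split=> [l x|k l x kl]; have [piK pi0] := svalP (cid (pi_ex l)); first exact: piK.
exact: pi0.
Qed.

(** The image of this map has the universal property of [M] for maps into
itself, so its inclusion has a section. *)
Lemma direct_sum_span m :
  exists x : free R {k & F k}, free_ext (fun s : {k & F k} => iota (tag s) (tagged s)) x = m.
Proof.
pose f : {linear free R {k & F k} -> M} := free_ext (fun s : {k & F k} => iota (tag s) (tagged s)).
have gK k : linear (fun x : F k => to_image f (gen R (Tagged F x))).
  by move=> a x y; apply: val_inj; rewrite /= /f !free_ext_gen /= linearP.
have [h [hE _]] := M_sum (fun k => linear_of (gK k)).
have [id [_ id_uniq]] := M_sum iota.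
have hid : image_incl f (h m) = m.
  transitivity (id m); last exact/esym/(id_uniq idfun).
  apply: (id_uniq (image_incl f \o h)) => k x.
  by rewrite /= hE /= /f free_ext_gen.
case: (h m) hid => y yP /= <-.
by have /asboolP := yP.
Qed.

End DirectSum.

(** Each generator of the direct sum has components in finitely many degrees,
so the projections to all other degrees vanish. *)
Lemma finite_complex_bounded (F : complex R) : finite_complex F ->
  exists B : nat, forall k (x : F k), (B < `|k|)%N -> x = 0.
Proof.
move=> [M [iota [M_sum [n [e eP]]]]].
have [pi [piK pi0]] := direct_sum_proj M_sum.
have bp m : exists B : nat, forall l : int, (B < `|l|)%N -> pi l m = 0.
  have [x <-] := direct_sum_span M_sum m; move: x; apply: free_ind.
  - by exists 0%N => l _; rewrite !linear0.
  - move=> [k x]; exists `|k|%N => l kl; rewrite free_ext_gen pi0 //= => E.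
    by rewrite E ltnn in kl.
  - by move=> x [B Bx]; exists B => l Bl; rewrite !linearN Bx ?oppr0.
  - move=> x y [B Bx] [B' By]; exists (maxn B B') => l.
    by rewrite gtn_max => /andP[Bl Bl']; rewrite !linearD Bx ?By ?addr0.
  - by move=> r x [B Bx]; exists B => l Bl; rewrite !linearZ /= Bx ?scaler0.
have [B BP] := boolp.choice (fun i => bp (e i)).
exists (\max_i B i) => k x Bk; rewrite -(piK k x).
have [c ->] := eP (iota k x); rewrite linear_sum big1 // => i _.
by rewrite linearZ /= BP ?scaler0 //; apply: leq_ltn_trans Bk; exact: leq_bigmax.
Qed.

Lemma h_finite_bounded (C : complex R) : h_finite C ->
  exists B : nat, forall k : int, (B < `|(k + 1)%R|)%N -> exact_at C k.
Proof.
move=> [F [_ /finite_complex_bounded[B FB] [f [g [[h hE] _]]]]].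
exists B => k Bk x dx; exists (- h (k + 1) x).
have := hE k x; rewrite dx linear0 addr0 /= (FB _ (f (k + 1) x) Bk) linear0 sub0r.
by move=> xE; rewrite linearN -xE opprK.
Qed.

Lemma contractible_exact (C : complex R) : contractible C -> forall k, exact_at C k.
Proof.
move=> [h hE] k x dx; exists (h (k + 1) x).
have := hE k x; rewrite dx [X in _ = _ + X]linear0 addr0 => <-; exact: subr0.
Qed.

Lemma homology_equivalence_exact (C D : complex R) (f : chain_map C D) :
  homology_equivalence f -> (forall k, exact_at C k) -> forall k, exact_at D k.
Proof.
move=> f_eq C_exact k y dy; have [x [dx [z zE]]] := (f_eq k).2 y dy.
have [x' x'E] := C_exact k x dx; exists (f (k + 1 + 1) x' - z).
by rewrite linearB -chain_comm x'E zE subKr.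
Qed.

End Finiteness.

Section ClassAn.
Variables (R : pzRingType) (S : bimodule R) (n : nat) (Y : D0_complex S).
Hypothesis YA : class_An n Y.

Lemma class_An_exact0 k : exact_at (Y 0%N) k.
Proof.
case: YA => -[Y0 _ _ _] _ x _; exists 0.
by rewrite linear0 (Y0 _ x).
Qed.

Lemma class_An_exact i k : (n <= i)%N -> exact_at (Y i) k.
Proof.
case: YA => -[_ _ _ Yeq] Yn; move=> /subnK <-; move: k.
elim: (i - n)%N => [|j IH]; first exact: contractible_exact.
exact: homology_equivalence_exact (Yeq _ (leq_addl _ _)) IH.
Qed.

Lemma class_An_bounded : exists B : nat, forall i k,
  (B < `|(k + 1)%R|)%N -> exact_at (Y i) k.
Proof.
case: YA => -[_ Yfin _ _] _.
have [B BP] := boolp.choice (fun i => h_finite_bounded (Yfin i)).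
exists (\max_(i < n) B i) => i k Bk.
have [ni|i_n] := leqP n i; first exact: class_An_exact.
apply: BP; apply: leq_ltn_trans Bk.
exact: (@leq_bigmax _ (fun i : 'I_n => B i) (Ordinal i_n)).
Qed.

End ClassAn.

(** * Homology equivalences of kernels and acyclic fibres *)

Section KernelComplexes.
Variables (R : pzRingType) (S : bimodule R) (C : D0_complex S).

Lemma ker_elt i k (x : C i.+1 k) : d0_alpha C i k x = 0 ->
  exists z : ker_alpha C i k, val z = x.
Proof. by move=> /eqP x0; exists (Kernel x0). Qed.

Lemma ker_eltP i k (z : ker_alpha C i k) : d0_alpha C i k (val z) = 0.
Proof. exact/eqP/(ker_valP z). Qed.

Lemma fiber_exact_of_equivalence p :
  homology_equivalence (ker_lambda C p) -> fiber_exact C p.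
Proof.
move=> K_eq k x w ax aw dx dw.
have [x' x'E] := ker_elt ax; have [w' w'E] := ker_elt aw; subst x w.
have cyc (y : ker_alpha C p (k + 1)) : diff (C p.+1) k (val y) = 0 -> is_cycle y.
  by move=> dy; apply: val_inj.
have [|z zE] := (K_eq k).1 x' 0 (cyc _ dx) (linear0 _).
  exists w'; rewrite linear0 subr0; exact: val_inj.
rewrite subr0 in zE.
have dz : diff (C p.+1) (k + 1) (val z) = val x' by rewrite -zE.
have [|y [dy [t tE]]] := (K_eq (k + 1)).2 (w' - ker_lambda C p _ z).
  apply: val_inj; rewrite /= !linearB /= dw -chain_comm dz; exact: subrr.
exists (val (z + y)), (- val t); split.
- exact: ker_eltP.
- by rewrite linearN ker_eltP oppr0.
- by have /(congr1 val) := dy; rewrite linearD /= dz => ->; rewrite addr0.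
- have /= dt : diff (C p.+2) (k + 1 + 1) (val t) = d0_lambda C p.+1 _ (val y) -
      (val w' - d0_lambda C p.+1 _ (val z)).
    by have := congr1 val tE; rewrite !linearB.
  by rewrite [in RHS]linearN dt opprB linearD [RHS]addrACA subrr addr0 [RHS]addrC subrK.
Qed.

End KernelComplexes.

(** * Test objects in A_n *)

Section OptionalGenerator.
Variable R : pzRingType.
Implicit Types b : bool.

(** Free of rank one or zero according to a boolean; the cells of the test
objects are switched on by their index and degree, and [opt_map] below is the
identity where both ends are present. *)
Definition opt_mod (b : bool) : rmodType R := if b then (free R unit : rmodType R) else zero_mod R.

Definition opt_gen (b : bool) : opt_mod b := if b is true then gen R tt else 0.

Definition opt_ext (b : bool) (N : rmodType R) (c : N) : {linear opt_mod b -> N} :=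
  if b is true return {linear opt_mod b -> N} then free_ext (fun=> c) else \0.

Lemma opt_ext_gen b (N : rmodType R) (c : N) : b -> opt_ext b c (opt_gen b) = c.
Proof. by case: b => //= _; rewrite free_ext_gen. Qed.

Lemma eq_opt b (N : rmodType R) (h h' : {linear opt_mod b -> N}) :
  (b -> h (opt_gen b) = h' (opt_gen b)) -> h =1 h'.
Proof.
case: b h h' => h h' hh' x; last by rewrite (zero_mod_eq0 x) !linear0.
by move: x; apply: eq_free => -[]; exact: hh'.
Qed.

Lemma opt_eq0 b (x : opt_mod b) : ~~ b -> x = 0.
Proof. by case: b x => // x _; exact: zero_mod_eq0. Qed.

Lemma opt_projective b : projective (opt_mod b).
Proof.
case: b; first exact: free_projective.
by apply: projective_trivial; exact: zero_mod_eq0.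
Qed.

Lemma opt_span b (x : opt_mod b) : exists c : R^c, x = c *: opt_gen b.
Proof.
case: b x => x; last by exists 0; rewrite scaler0; exact: zero_mod_eq0.
move: x; apply: free_ind => [|[]|x [c ->]|x y [c ->] [d ->]|r x [c ->]].
- by exists 0; rewrite scale0r.
- by exists 1; rewrite scale1r.
- by exists (- c); rewrite scaleNr.
- by exists (c + d); rewrite scalerDl.
- by exists (r * c); rewrite scalerA.
Qed.

Definition opt_map (b b' : bool) : {linear opt_mod b -> opt_mod b'} := opt_ext b (opt_gen b').

Lemma opt_ext_map b b' (N : rmodType R) (c : N) x :
  opt_ext b' c (opt_map b b' x) = if b' then opt_ext b c x else 0.
Proof.
case: b' => [|//]; pose h : {linear opt_mod b -> N} := opt_ext true c \o opt_map b true.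
rewrite -[LHS]/(h x); move: x; apply: eq_opt => bT.
by rewrite /= !(opt_ext_gen _ bT) free_ext_gen.
Qed.

Lemma opt_map_map b1 b2 b3 x :
  opt_map b2 b3 (opt_map b1 b2 x) = if b2 then opt_map b1 b3 x else 0.
Proof. exact: opt_ext_map. Qed.

Lemma opt_map_id b : opt_map b b =1 id.
Proof.
move=> x; rewrite -[RHS]/((idfun : {linear opt_mod b -> opt_mod b}) x).
by move: x; apply: eq_opt => bT; rewrite [LHS]opt_ext_gen.
Qed.

Lemma opt_mapK b b' (x : opt_mod b) : (b -> b') -> opt_map b' b (opt_map b b' x) = x.
Proof.
case: b b' x => [] [] x bb'; rewrite ?opt_map_id //; first by have := bb' isT.
by rewrite (opt_eq0 x isT); exact: opt_eq0.
Qed.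

Lemma opt_short_exact b1 b2 b3 : (b1 -> b2) -> b3 = b2 && ~~ b1 ->
  short_exact (opt_map b1 b2) (opt_map b2 b3).
Proof.
move=> b12 b3E; case: b1 b2 b3 b12 b3E => [] [] [] // b12 _.
- split=> [x y|y|z]; first by rewrite !opt_map_id.
    by split=> _; [exists y; rewrite opt_map_id | exact: zero_mod_eq0].
  by exists 0; rewrite linear0 (zero_mod_eq0 z).
- by have := b12 isT.
- split=> [x y _|y|z]; first by rewrite (zero_mod_eq0 x) (zero_mod_eq0 y).
    rewrite opt_map_id; split=> [->|[x <-]]; first by exists 0; rewrite linear0.
    by rewrite (zero_mod_eq0 x) linear0.
  by exists z; rewrite opt_map_id.
- split=> [x y _|y|z]; first by rewrite (zero_mod_eq0 x) (zero_mod_eq0 y).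
    by split=> _; [exists y; rewrite opt_map_id | exact: zero_mod_eq0].
  by exists z; rewrite opt_map_id.
Qed.

End OptionalGenerator.

Lemma short_exact_pair (R : pzRingType) (A B C A' B' C' : rmodType R)
    (f : {linear A -> B}) (g : {linear B -> C})
    (f' : {linear A' -> B'}) (g' : {linear B' -> C'}) :
  short_exact f g -> short_exact f' g' ->
  short_exact (pairl (f \o fst) (f' \o snd) : {linear (A * A')%type -> (B * B')%type})
    (pairl (g \o fst) (g' \o snd) : {linear (B * B')%type -> (C * C')%type}).
Proof.
move=> [f_inj fg g_surj] [f'_inj fg' g'_surj]; split.
- by move=> [x x'] [y y'] /= [/f_inj-> /f'_inj->].
- move=> [y y']; split=> [[/fg[x xE] /fg'[x' x'E]]|[[x x'] [<- <-]]].
    by exists (x, x'); rewrite /= xE x'E.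
  by congr (_, _); [apply/fg; exists x | apply/fg'; exists x'].
- move=> [z z']; have [y yE] := g_surj z; have [y' y'E] := g'_surj z'.
  by exists (y, y'); rewrite /= yE y'E.
Qed.

Section TwoCells.
Variables (R : pzRingType) (r : int).
Implicit Types a b : bool.

Definition two_cells_term (a b : bool) (j : int) : rmodType R :=
  (opt_mod R (a && (j == r)) * opt_mod R (b && (j == r + 1)%R))%type.

(** A generator in degree [r], present when [a] holds, and one in degree
[r + 1], present when [b] holds, with the first as its boundary. *)
Definition two_cells_diff a b (j : int) :
    {linear two_cells_term a b (j + 1) -> two_cells_term a b j} :=
  inl_lin _ _ \o (opt_map _ _ _ \o snd).

Lemma two_cells_diffK a b j x :
  two_cells_diff a b j (two_cells_diff a b (j + 1) x) = 0.
Proof. by rewrite /= linear0. Qed.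

Definition two_cells (a b : bool) : complex R :=
  @Complex R (two_cells_term a b) (two_cells_diff a b) (@two_cells_diffK a b).

Lemma two_cells_projective a b : projective_complex (two_cells a b).
Proof. by move=> j; apply: projective_pair; exact: opt_projective. Qed.

Definition cells_map_fun (a b a' b' : bool) (j : int) : {linear two_cells a b j -> two_cells a' b' j} :=
  pairl (opt_map _ _ _ \o fst) (opt_map _ _ _ \o snd).

Lemma cells_map_comm a b a' b' : b && a' ==> (a == b') -> forall j x,
  cells_map_fun a b a' b' j (diff (two_cells a b) j x) =
  diff (two_cells a' b') j (cells_map_fun a b a' b' (j + 1) x).
Proof.
move=> ab j [e e']; congr (_, _); last exact: linear0.
rewrite /= !opt_map_map; move: e'; rewrite (inj_eq (addIr _)) => e'.
case/orP: (orbN (b && (j == r))) => [bT|bF]; last first.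
  by rewrite (opt_eq0 e' bF) !linear0 !if_same.
case/orP: (orbN (a' && (j == r))) => [a'T|a'F]; last first.
  by rewrite [opt_map _ _ _ _](opt_eq0 _ a'F) !if_same.
suff -> : a && (j == r) = b' && (j == r) by [].
by move: bT a'T ab => /andP[-> _] /andP[-> _] /= /eqP ->.
Qed.

Definition cells_map a b a' b' (ab : b && a' ==> (a == b')) :
    chain_map (two_cells a b) (two_cells a' b') :=
  ChainMap (cells_map_comm ab).

Lemma cells_contractible a : contractible (two_cells a a).
Proof.
exists (fun j => inr_lin _ _ \o (opt_map R _ _ \o fst)
  : {linear two_cells a a j -> two_cells a a (j + 1)}) => j [e e'].
have slotS k : a && (k + 1 == r + 1) = (a && (k == r)) by rewrite (inj_eq (addIr _)).
by congr (_, _); rewrite /= subr0 opt_mapK ?addr0 ?add0r // slotS.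
Qed.

(** The quotient has the generators present in the target only. *)
Lemma cells_cofibration a b a' : (b ==> a) -> (a ==> a') ->
  forall ab : b && a' ==> (a == a), cofibration (cells_map ab).
Proof.
move=> ba aa' ab.
have qP : a && (a' && ~~ a) ==> (a' == (a && ~~ b)) by case: a {ba aa' ab}; rewrite ?andbF.
exists (two_cells (a' && ~~ a) (a && ~~ b)), (cells_map qP).
split; first exact: two_cells_projective.
move=> j; apply: short_exact_pair; apply: opt_short_exact.
- by move: aa' => /implyP aa' /andP[/aa' -> ->].
- by case: (j == r); rewrite ?andbF ?andbT.
- by move: ba => /implyP ba /andP[/ba -> ->].
- by case: (j == r + 1); rewrite ?andbF ?andbT.
Qed.

Lemma cells_finite a b : finite_complex (two_cells a b).
Proof.
pose M : rmodType R := (opt_mod R a * opt_mod R b)%type.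
pose iota j : {linear two_cells a b j -> M} :=
  pairl (opt_map R _ _ \o fst) (opt_map R _ _ \o snd).
exists M, iota; split=> [N g|]; last first.
  exists 2, (fun i => if i == ord0 then (opt_gen R a, 0) else (0, opt_gen R b)).
  move=> [x x']; have [c ->] := opt_span x; have [c' ->] := opt_span x'.
  exists (fun i => if i == ord0 then c else c').
  rewrite !big_ord_recl big_ord0 addr0 /=.
  by congr (_, _); rewrite /= scaler0 ?addr0 ?add0r.
have ar : a -> a && (r == r) by rewrite eqxx andbT.
have br : b -> b && (r + 1 == r + 1) by rewrite eqxx andbT.
pose h : {linear M -> N} := copairl (g r \o (inl_lin _ _ \o opt_map R a (a && (r == r))))
  (g (r + 1) \o (inr_lin _ _ \o opt_map R b (b && (r + 1 == r + 1)))).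
exists h; split=> [j [e e']|h' h'E [x x']].
  transitivity (g j (e, 0) + g j (0, e')); last first.
    by rewrite -linearD; congr (g j (_, _)); rewrite /= ?addr0 ?add0r.
  congr (_ + _).
    case/orP: (orbN (j == r)) => [/eqP jr|jr]; first by subst j; rewrite /= opt_mapK // => /andP[].
    have e0 : e = 0 by apply: opt_eq0; rewrite (negPf jr) andbF.
    by rewrite e0 [(iota j _).1]linear0 !linear0.
  case/orP: (orbN (j == r + 1)) => [/eqP jr|jr]; first by subst j; rewrite /= opt_mapK // => /andP[].
  have e0 : e' = 0 by apply: opt_eq0; rewrite (negPf jr) andbF.
  by rewrite e0 [(iota j _).2]linear0 !linear0.
have xx' : (x, x') = iota r (opt_map R a _ x, 0) + iota (r + 1) (0, opt_map R b _ x').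
  by congr (_, _); rewrite /= !linear0 ?addr0 ?add0r opt_mapK.
by rewrite [in LHS]xx' linearD !h'E.
Qed.

Lemma cells_h_finite a b : h_finite (two_cells a b).
Proof.
exists (two_cells a b); split; first exact: two_cells_projective.
  exact: cells_finite.
exists (chain_id _), (chain_id _); split; exists (fun j => \0) => j x;
  by rewrite /= linear0 addr0 subrr.
Qed.

End TwoCells.

Section AtDegree.
Variable R : pzRingType.

Definition at_deg (M : int -> rmodType R) r (x : M r) j : M j :=
  match @eqP int r j with ReflectT E => eq_rect r M x j E | ReflectF _ => 0 end.

Lemma at_degE (M : int -> rmodType R) r (x : M r) : at_deg x r = x.
Proof. by rewrite /at_deg; case: eqP => // E; rewrite (eq_irrelevance E erefl). Qed.

End AtDegree.

(** The free complex on one generator of degree [k + 1] at index [m], and its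
cone at the later indices. *)
Section TestObject.
Variables (R : pzRingType) (S : bimodule R) (m : nat) (k : int).
Notation r := (k + 1).

Definition test_obj i : complex R := two_cells R r (m <= i)%N (m < i)%N.

Lemma test_lambda_subproof i : (m < i)%N && (m <= i.+1)%N ==> ((m <= i)%N == (m < i.+1)%N).
Proof. by rewrite ltnS eqxx implybT. Qed.

Definition test_lambda i : chain_map (test_obj i) (test_obj i.+1) :=
  cells_map R r (test_lambda_subproof i).

Definition test_complex : D0_complex S := @D0Complex R S test_obj
  (fun i => @two_cells_projective R r _ _) test_lambda
  (fun i => chain_zero (test_obj i.+1) (tens_complex S (test_obj i)))
  (fun i k x => esym (linear0 _)).

Lemma test_class_An n : (0 < m)%N -> (m < n)%N -> class_An n test_complex.
Proof.
move=> m0 mn.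
have test_contractible i : (m < i)%N -> contractible (test_obj i).
  by move=> mi; rewrite /test_obj mi (ltnW mi); exact: cells_contractible.
split; last exact: test_contractible.
split=> [k' [e e']|i|i|i ni].
- by congr (_, _); apply: opt_eq0; rewrite ?ltn0 // leqNgt m0.
- exact: cells_h_finite.
- apply: (@cells_cofibration R r (m <= i)%N (m < i)%N (m <= i.+1)%N);
    by apply/implyP => mi; exact: ltnW.
- have acyc j : (m < j)%N -> forall k, exact_at (test_obj j) k.
    by move=> mj; apply/contractible_exact/test_contractible.
  have mi : (m < i)%N := leq_trans mn ni.
  move=> k'; split=> [x y dx dy _|y dy].
    have [|z zE] := acyc i mi k' (x - y); last by exists z.
    by rewrite linearB dx dy subrr.
  have [z zE] := acyc i.+1 (ltnW mi) k' y dy.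
  exists 0; split; first exact: linear0.
  by exists (- z); rewrite linearN zE linear0 sub0r.
Qed.

End TestObject.

Lemma eq_two_cells (R : pzRingType) (r : int) (a b : bool) (j : int) (N : rmodType R)
    (F G : {linear two_cells R r a b j -> N}) :
  (a -> j = r -> F (opt_gen R _, 0) = G (opt_gen R _, 0)) ->
  (b -> j = r + 1 -> F (0, opt_gen R _) = G (0, opt_gen R _)) -> F =1 G.
Proof.
move=> FG FG'; apply: eq_on_pairs.
  pose I := inl_lin (opt_mod R (a && (j == r))) (opt_mod R (b && (j == r + 1))).
  by apply: (@eq_opt R _ _ (F \o I) (G \o I)) => /andP[aT /eqP]; exact: FG.
pose I := inr_lin (opt_mod R (a && (j == r))) (opt_mod R (b && (j == r + 1))).
by apply: (@eq_opt R _ _ (F \o I) (G \o I)) => /andP[bT /eqP]; exact: FG'.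
Qed.

(** Maps from the test object: [X i] and [W i] are the values of the two
generators at index [i]. *)
Section TestMap.
Variables (R : pzRingType) (S : bimodule R) (C : D0_complex S) (m : nat) (k : int).
Notation r := (k + 1).
Variables (X : forall i, C i r) (W : forall i, C i (r + 1)).
Hypothesis X_lambda : forall i, (m <= i)%N -> X i.+1 = d0_lambda C i r (X i).
Hypothesis W_lambda : forall i, (m < i)%N -> W i.+1 = d0_lambda C i (r + 1) (W i).
Hypothesis dX : forall i, (m <= i)%N -> diff (C i) k (X i) = 0.
Hypothesis dW : forall i, (m < i)%N -> diff (C i) r (W i) = X i.
Hypothesis aX : forall i, (m <= i.+1)%N -> d0_alpha C i r (X i.+1) = 0.
Hypothesis aW : forall i, (m < i.+1)%N -> d0_alpha C i (r + 1) (W i.+1) = 0.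

Notation T := (test_complex S m k).

Definition test_fun i j : {linear T i j -> C i j} :=
  copairl (opt_ext _ (at_deg (X i) j)) (opt_ext _ (at_deg (W i) j)).

Lemma test_fun_bottom i : (m <= i)%N -> test_fun i r (opt_gen R _, 0) = X i.
Proof. by move=> mi; rewrite /= linear0 addr0 opt_ext_gen ?mi ?eqxx // at_degE. Qed.

Lemma test_fun_top i : (m < i)%N -> test_fun i (r + 1) (0, opt_gen R _) = W i.
Proof. by move=> mi; rewrite /= linear0 add0r opt_ext_gen ?mi ?eqxx // at_degE. Qed.

Lemma test_comm i j x :
  test_fun i j (diff (T i) j x) = diff (C i) j (test_fun i (j + 1) x).
Proof.
move: x; apply: (@eq_two_cells R _ _ _ _ _ (test_fun i j \o diff (T i) j)
  (diff (C i) j \o test_fun i (j + 1))) => [mi /(addIr _) jk|mi /(addIr _) jk]; subst j.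
  rewrite [RHS](congr1 (diff (C i) k) (test_fun_bottom mi)) dX //.
  by rewrite [LHS]/= !linear0 addr0.
rewrite [RHS](congr1 (diff (C i) r) (test_fun_top mi)) dW // -(test_fun_bottom (ltnW mi)).
congr (test_fun i r (_, _)); apply: opt_ext_gen; by rewrite mi eqxx.
Qed.

Definition test_chain i : chain_map (T i) (C i) := ChainMap (@test_comm i).

Lemma test_lam i j x :
  test_chain i.+1 j (d0_lambda T i j x) = d0_lambda C i j (test_chain i j x).
Proof.
move: x; apply: (@eq_two_cells R _ _ _ _ _ (test_fun i.+1 j \o d0_lambda T i j)
  (d0_lambda C i j \o test_fun i j)) => mi jr; subst j.
  rewrite [RHS](congr1 (d0_lambda C i r) (test_fun_bottom mi)) -X_lambda //.
  rewrite -(test_fun_bottom (leqW mi)).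
  congr (test_fun i.+1 r (_, _)); last exact: linear0.
  by apply: opt_ext_gen; rewrite mi eqxx.
rewrite [RHS](congr1 (d0_lambda C i (r + 1)) (test_fun_top mi)) -W_lambda //.
rewrite -(test_fun_top (leqW mi)).
congr (test_fun i.+1 (r + 1) (_, _)); first exact: linear0.
by apply: opt_ext_gen; rewrite mi eqxx.
Qed.

Lemma test_alpha i j x :
  tens_chain S (test_chain i) j (d0_alpha T i j x) =
  d0_alpha C i j (test_chain i.+1 j x).
Proof.
rewrite [LHS]linear0; apply/esym.
move: x; apply: (@eq_two_cells R _ _ _ _ _ (d0_alpha C i j \o test_fun i.+1 j) \0)
  => mi jr; subst j.
  by rewrite [LHS](congr1 (d0_alpha C i r) (test_fun_bottom mi)) aX.
by rewrite [LHS](congr1 (d0_alpha C i (r + 1)) (test_fun_top mi)) aW.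
Qed.

Definition test_map : D0_map T C := @D0Map R S T C test_chain test_lam test_alpha.

End TestMap.

(** The images of [x] under the iterates of lambda, defined at all indices with
the value zero below [a], so that no index of the form a + j occurs. *)
Section Orbit.
Variables (R : pzRingType) (S : bimodule R) (C : D0_complex S) (a : nat) (r : int).
Variable x : C a r.

Fixpoint orbit i : C i r :=
  match @eqP nat a i with
  | ReflectT E => eq_rect a (fun i => C i r) x i E
  | ReflectF _ => if i is j.+1 return C i r then d0_lambda C j r (orbit j) else 0
  end.

Lemma orbit_base : orbit a = x.
Proof.
have E i (E : a = i) : orbit i = eq_rect a (fun i => C i r) x i E.
  by case: i E => [|i] E /=; case: eqP => // E'; rewrite (eq_irrelevance E E').
exact: (E a erefl).
Qed.

Lemma orbit_lambda i : (a <= i)%N -> orbit i.+1 = d0_lambda C i r (orbit i).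
Proof.
move=> ai /=; case: eqP => // E; exfalso; lia.
Qed.

Lemma orbit_ind (P : forall i, C i r -> Prop) : P a x ->
  (forall i y, (a <= i)%N -> P i y -> P i.+1 (d0_lambda C i r y)) ->
  forall i, (a <= i)%N -> P i (orbit i).
Proof.
move=> Pa PS i /subnK <-; elim: (i - a)%N => [|j IH]; first by rewrite orbit_base.
by rewrite addSn orbit_lambda ?leq_addl //; apply: PS; rewrite ?leq_addl.
Qed.

End Orbit.

(** * Local objects and acyclic fibres *)

Section LocalImpliesExact.
Variables (R : pzRingType) (S : bimodule R) (C : D0_complex S) (n : nat).
Hypothesis S_flat : flat_on_left S.
Hypothesis C_reduced : D0_reduced C.

(** The pair (x, w) is a map from the test object. In an acyclic [Z] through
which it factors, [z] and [w'] bound the images of the generators, and [u] and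
[t] bound the values of alpha on them; [v] and [s] lift the images of [u] and
[t] to [C] and correct the images of [z] and [w'] so that alpha vanishes. *)
Lemma fiber_exact_of_local p : local_for (class_An n) C -> (p.+1 < n)%N ->
  fiber_exact C p.
Proof.
move=> C_local pn k x w ax aw dx dw.
pose X := orbit x; pose W := orbit w.
have Xl i : (p.+1 <= i)%N -> X i.+1 = d0_lambda C i (k + 1) (X i) by exact: orbit_lambda.
have Wl i : (p.+1 < i)%N -> W i.+1 = d0_lambda C i (k + 1 + 1) (W i) by exact: orbit_lambda.
have dX i : (p.+1 <= i)%N -> diff (C i) k (X i) = 0.
  apply: (orbit_ind (P := fun i y => diff (C i) k y = 0)) => // j y _ dy.
  by rewrite -chain_comm dy linear0.
have dW i : (p.+1 < i)%N -> diff (C i) (k + 1) (W i) = X i.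
  apply: (orbit_ind (P := fun i y => diff (C i) (k + 1) y = X i)).
    by rewrite dw Xl // /X orbit_base.
  by move=> j y pj dy; rewrite -chain_comm dy Xl // ltnW.
have aX i : (p.+1 <= i.+1)%N -> d0_alpha C i (k + 1) (X i.+1) = 0.
  move=> pi; apply: (orbit_ind (P := fun i => if i is j.+1 return C i (k + 1) -> Prop
    then fun y => d0_alpha C j (k + 1) y = 0 else fun _ => True) _ _ pi) => //.
  by move=> [|j] y // _ ay; rewrite d0_comm ay linear0.
have aW i : (p.+1 < i.+1)%N -> d0_alpha C i (k + 1 + 1) (W i.+1) = 0.
  move=> pi; apply: (orbit_ind (P := fun i => if i is j.+1 return C i (k + 1 + 1) -> Prop
    then fun y => d0_alpha C j (k + 1 + 1) y = 0 else fun _ => True) _ _ pi) => //.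
  by move=> [|j] y // _ ay; rewrite d0_comm ay linear0.
pose phi := test_map Xl Wl dX dW aX aW.
have [Z [g [h [Zac hg]]]] := C_local _ phi (test_class_An S k (ltn0Sn p) pn).
have Zex i l : exact_at (Z i) l by exact: ((acyclicP _).1 (Zac i)).
have Zt i l : exact_at (tens_complex S (Z i)) l by exact: flat_exact_at.
pose T := test_complex S p.+1 k.
pose ex : T p.+1 (k + 1) := (opt_gen R _, 0).
pose ew : T p.+2 (k + 1 + 1) := (0, opt_gen R _).
have hx : h p.+1 (k + 1) (g p.+1 (k + 1) ex) = x.
  by rewrite -hg -[RHS](orbit_base x); apply: test_fun_bottom.
have hw : h p.+2 (k + 1 + 1) (g p.+2 (k + 1 + 1) ew) = w.
  by rewrite -hg -[RHS](orbit_base w); apply: test_fun_top.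
have dex : diff (T p.+1) k ex = 0.
  by congr (_, _); exact: linear0.
have dew : diff (T p.+2) (k + 1) ew = d0_lambda T p.+1 (k + 1) ex.
  congr (_, _); last exact/esym/linear0.
  rewrite [LHS]opt_ext_gen ?ltnSn ?eqxx //.
  by rewrite [RHS]opt_ext_gen ?leqnn ?eqxx.
have [z zE] : exists z, diff (Z p.+1) (k + 1) z = g p.+1 (k + 1) ex.
  by apply: Zex; rewrite -chain_comm dex linear0.
have [u uE] : exists u, diff (tens_complex S (Z p)) (k + 1 + 1) u =
    d0_alpha Z p (k + 1 + 1) z.
  by apply: Zt; rewrite -chain_comm zE -d0_fun_alpha linear0.
have [w' w'E] : exists w', diff (Z p.+2) (k + 1 + 1) w' =
    g p.+2 (k + 1 + 1) ew - d0_lambda Z p.+1 (k + 1 + 1) z.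
  apply: Zex; rewrite linearB -!chain_comm dew zE d0_fun_lambda; exact: subrr.
have [t tE] : exists t, diff (tens_complex S (Z p.+1)) (k + 1 + 1 + 1) t =
    d0_alpha Z p.+1 (k + 1 + 1 + 1) w' + tens_chain S (d0_lambda Z p) (k + 1 + 1 + 1) u.
  apply: Zt; rewrite linearD -!chain_comm w'E uE linearB -d0_fun_alpha linear0 sub0r.
  by rewrite d0_comm addNr.
have [v vE] := C_reduced (tens_chain S (h p) (k + 1 + 1 + 1) u).
have [s sE] := C_reduced (tens_chain S (h p.+1) (k + 1 + 1 + 1 + 1) t).
exists (h p.+1 (k + 1 + 1) z - diff (C p.+1) (k + 1 + 1) v).
exists (h p.+2 (k + 1 + 1 + 1) w' + d0_lambda C p.+1 (k + 1 + 1 + 1) v -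
  diff (C p.+2) (k + 1 + 1 + 1) s).
split.
- by rewrite linearB chain_comm vE -d0_fun_alpha -chain_comm uE subrr.
- rewrite linearB linearD chain_comm sE -d0_fun_alpha d0_comm vE -chain_comm tE.
  rewrite [X in _ - X]linearD (_ : tens_chain S (d0_lambda C p) _ _ =
    tens_chain S (h p.+1) (k + 1 + 1 + 1) (tens_chain S (d0_lambda Z p) (k + 1 + 1 + 1) u)).
    exact: subrr.
  by rewrite /= !tens_map_comp; apply: eq_tens_map => y; exact/esym/d0_fun_lambda.
- by rewrite linearB diffK subr0 -chain_comm zE hx.
- rewrite [X in _ = _ + X]linearB diffK subr0 [X in _ = _ + X]linearD.
  rewrite -!chain_comm w'E linearB [X in _ = _ + (X + _)]linearB hw d0_fun_lambda.
  by rewrite [RHS]addrACA addNr addr0 [RHS]addrC subrK.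
Qed.

Lemma equivalence_of_fiber_exact p :
  fiber_exact C p -> homology_equivalence (ker_lambda C p).
Proof.
move=> C_fib k; split=> [x y dx dy [w wE]|].
  have vxy : val (x - y) = val x - val y by rewrite linearB.
  have [||||z [_ [az _ dz _]]] := C_fib k (val (x - y)) (val w); rewrite ?ker_eltP //.
  - by rewrite vxy linearB -[diff _ k (val x)]/(val (diff _ k x)) dx
      -[diff _ k (val y)]/(val (diff _ k y)) dy subrr.
  - have /(congr1 val) := wE; rewrite vxy !linearB; exact.
  by have [z' z'E] := ker_elt az; exists z'; apply: val_inj; rewrite /= z'E.
have [l lE] := int_pred k; subst k => y dy.
have [||||z [t [az at0 dz yE]]] := C_fib l 0 (val y); rewrite ?ker_eltP ?linear0 //.
  exact: (congr1 val dy).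
have [z' z'E] := ker_elt az; have [t' t'E] := ker_elt at0.
exists z'; split; first by apply: val_inj; rewrite /= z'E dz.
exists (- t'); apply: val_inj.
rewrite [RHS]linearB [RHS]/= z'E.
rewrite linearN [LHS]linearN [LHS]/= t'E.
by rewrite (yE : ker_val y = _) opprD addrA subrr sub0r.
Qed.

End LocalImpliesExact.

Theorem proposition5 (R : pzRingType) (S : bimodule R) (n : nat)
    (C : D0_complex S) :
  vogel_regular R -> flat_on_left S ->
  D0_reduced C -> completion (@class_A R S) C ->
  (local_for (class_An n) C <->
   forall m : nat, (1 <= m < n)%N -> homology_equivalence (ker_lambda C m.-1)).
Proof.
move=> _ S_flat C_reduced _; split=> [C_local [//|p] /= pn|K_eq Y f YA].
  exact/equivalence_of_fiber_exact/(fiber_exact_of_local S_flat C_reduced C_local).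
have C_fiber p : (p.+1 < n)%N -> fiber_exact C p.
  by move=> pn; exact: (fiber_exact_of_equivalence (K_eq p.+1 pn)).
  (* The homology of [Y] lies in the degrees from -B to B, and [k] is one less
     than the degree. *)
have [B Yb] := class_An_bounded YA.
have [||||Z [h [g [Zac fE]]]] := kill_all S_flat C_reduced C_fiber f
    (a := - B%:Z - 1) (N := (B + B).+1).
- by move=> i k Bk; apply: Yb; lia.
- by move=> k; exact: (class_An_exact0 YA).
- by move=> i k; exact: (class_An_exact YA).
- by move=> i k kB; apply: Yb; lia.
by exists Z, g, h.
Qed.
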